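(* Let $d\ge 1$ be an integer, let the job size distribution be arbitrary with mean $1/\mu$, let $0<\lambda<\mu$, and let $\pi_0\in(0,1]$ be the equilibrium probability that the dispatcher's memory is empty. Let $R$ be the response time for the memory dependent version of the SQ($d$) policy with arrival rate $\lambda$ and this job size distribution. Let $\tilde R$ be the response time for the classic SQ($d$) policy (without memory) with the same job size distribution and arrival rate $\lambda\pi_0^{1/d}$. Then $R$ and $\tilde R$ have the same distribution.
   Context: Job sizes have a general distribution on $(0,\infty)$ with probability density function $g$ and complementary cdf $\bar G$. Queue at the cavity for SQ($d$) with memory, arrival rate $\lambda$, empty-memory probability $\pi_0$, in equilibrium: a single first-come-first-served, unit-speed queue whose state is (number of jobs $k\ge1$, remaining size $w>0$ of the job at the head of the queue), or empty. Let $x_k(w)$ be the equilibrium density of having exactly $k$ jobs and remaining head size $w$, and $u_k=\sum_{\ell\ge k}\int_0^\infty x_\ell(w)\,dw$ the equilibrium probability of having at least $k\ge1$ jobs. - Potential arrivals occur at rate $\lambda d\pi_0$. At a potential arrival, $d-1$ i.i.d. queue lengths with the equilibrium queue length law of the queue at the cavity are drawn, independent of its state; the job joins the queue at the cavity iff its queue length is the smallest of the $d$ values, ties being broken uniformly at random. - When the queue is empty there is an additional arrival rate $\lambda(1-\pi_0)/(1-u_1)$ (jobs routed to an idle server whose id is in memory). - Between arrivals the remaining size of the head job decreases at rate $1$; when it reaches $0$ the job leaves and the next job (if any) starts service with a fresh size drawn from density $g$. The equilibrium is a probability law on the state space that is stationary for this process with rates computed from that same law; ''the'' equilibrium is taken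 to exist and be unique, for the system with memory and for the system without memory. Response time $R$ (time from arrival until service completion) of an arriving job: with probability $1-\pi_0$ the job is sent to an idle server; with probability $\pi_0$ the job joins a queue of shortest length (ties broken uniformly at random) among $d$ independent queues, each in the equilibrium law of (queue length, remaining size of head job). The response time is the remaining size of the head job (if any), plus the sizes of the other waiting jobs, plus the job's own size, where the latter sizes are i.i.d. with density $g$. The classic SQ($d$) policy with arrival rate $\lambda'$ is the same model with $\lambda$ replaced by $\lambda'$ and $\pi_0$ replaced by $1$. *)

(* Defs.v *)
From HB Require Import structures.
From mathcomp Require Import all_boot all_order all_algebra.
From mathcomp Require Import all_classical all_reals all_analysis.

Set Implicit Arguments.
Unset Strict Implicit.
Unset Printing Implicit Defensive.

Import Order.TTheory GRing.Theory Num.Theory.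
Import numFieldNormedType.Exports.

Local Open Scope classical_set_scope.
Local Open Scope ring_scope.

Section LoadBalancing.
Context {R : realType}.

Local Notation Rpos := (`]0%R, +oo[%classic : set (measurableTypeR R)).
Local Notation mu := (@lebesgue_measure R).

(* A state [(k, w)] of a queue: [k] jobs, of which the one at the head has
   remaining size [w].  The empty queue is encoded by [(0, 0)]. *)
Local Notation state := (nat * measurableTypeR R)%type.

Definition njobs (s : state) : nat := s.1.
Definition head_size (s : state) : R := s.2.
Definition empty : state := (0%N, 0).

Definition valid_state : set state :=
  [set s | s = empty \/ (0 < njobs s)%N /\ 0 < head_size s].

Record job_size_density (g : R -> R) (m : R) : Prop := JobSizeDensity {
  density_measurable : measurable_fun Rpos g ;
  density_ge0 : forall v, 0 < v -> 0 <= g v ;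
  density_mass : (\int[mu]_(v in Rpos) (g v)%:E = 1)%E ;
  density_mean : (\int[mu]_(v in Rpos) (v * g v)%:E = m%:E)%E }.

(* Expectation of [h X] for a job size [X] with density [g]. *)
Definition job_expect (g : R -> R) (h : R -> \bar R) : \bar R :=
  (\int[mu]_(v in Rpos) ((g v)%:E * h v))%E.

(* Probability that [a] plus the sum of [n] independent job sizes is in [A]. *)
Fixpoint sum_sizes (g : R -> R) (n : nat) (a : R) (A : set R) : \bar R :=
  if n is n'.+1 then job_expect g (fun v => sum_sizes g n' (a + v)%R A)
  else (\1_A a)%:E.

(* Expectation of [h [:: S_1; ...; S_n]] for independent states [S_i] of
   law [p]. *)
Fixpoint iid_expect (p : probability state R) (n : nat)
    (h : seq state -> \bar R) : \bar R :=
  if n is n'.+1 then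
    (\int[p]_s iid_expect p n' (fun l => h (s :: l)))%E
  else h [::].

(* Probability of having at least [k] jobs. *)
Definition tail (p : probability state R) (k : nat) : R :=
  fine (p [set s | (k <= njobs s)%N]).

(* Probability that a queue of length [k] receives a job that is sent to a
   shortest queue, ties being broken uniformly at random, when the other [d - 1]
   queue lengths are drawn independently according to [p]. *)
Definition join_prob (p : probability state R) (d k : nat) : R :=
  fine (iid_expect p d.-1 (fun l =>
    (if all (fun s => (k <= njobs s)%N) l
     then ((count (fun s => njobs s == k) l).+1%:R)^-1 else 0)%:E)).

(* Rate at which jobs join a queue of length [k] when the other queues
   have law [p]: potential arrivals are thinned by [join_prob], and an empty
   queue also receives the jobs sent to idle servers held in memory. *)
Definition arrival_rate (d : nat) (lambda pi0 : R) (p : probability state R)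
    (k : nat) : R :=
  lambda * d%:R * pi0 * join_prob p d k
  + (if k is 0%N then lambda * (1 - pi0) / (1 - tail p 1) else 0).

(* Value of [h], averaged over the size of the job that starts service (if any),
   when a service starts with [k] jobs present. *)
Definition start_service (g : R -> R) (k : nat) (h : state -> \bar R) : \bar R :=
  if k is 0%N then h empty else job_expect g (fun v => h (k, v)).

(* [trans_lt g r n t s A] is the probability that the single server queue with
   arrival rate [r k] in presence of [k] jobs, started in [s], is in [A] at
   time [t] after having undergone fewer than [n] events (arrivals and service
   completions), by conditioning on the first event. *)
Fixpoint trans_lt (g : R -> R) (r : nat -> R) (n : nat) (t : R) (s : state)
    (A : set state) : \bar R :=
  if n is n'.+1 then
    match s with
    | (0%N, _) =>
      ((expR (- (r 0%N * t)) * \1_A empty)%:E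
       + \int[mu]_(a in `[0%R, t])
           ((r 0%N * expR (- (r 0%N * a)))%:E
            * start_service g 1 (fun s' => trans_lt g r n' (t - a)%R s' A)))%E
    | (k'.+1 as k, w) =>
      ((if (t < w)%R then (expR (- (r k * t)) * \1_A ((k, w - t) : state))%:E
        else (expR (- (r k * w)))%:E
             * start_service g k' (fun s' => trans_lt g r n' (t - w)%R s' A))
       + \int[mu]_(a in `[0%R, (Num.min t w)%R])
           ((r k * expR (- (r k * a)))%:E
            * trans_lt g r n' (t - a)%R (k.+1, (w - a)%R) A))%E
    end
  else 0%E.

(* Transition function of the queue. *)
Definition trans (g : R -> R) (r : nat -> R) (t : R) (s : state)
    (A : set state) : \bar R :=
  ereal_sup [set trans_lt g r n t s A | n in [set: nat]].

Definition stationary (g : R -> R) (r : nat -> R) (p : probability state R) :=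
  forall (t : R) (A : set state), 0 <= t -> measurable A ->
    (\int[p]_s trans g r t s A = p A)%E.

(* Equilibrium of the queue at the cavity; the arrival rates depend on the law
   itself. *)
Definition equilibrium (g : R -> R) (d : nat) (lambda pi0 : R)
    (p : probability state R) : Prop :=
  p (~` valid_state) = 0%E /\ stationary g (arrival_rate d lambda pi0 p) p.

Definition the_equilibrium (g : R -> R) (d : nat) (lambda pi0 : R)
    (p : probability state R) : Prop :=
  equilibrium g d lambda pi0 p /\
  forall q : probability state R, equilibrium g d lambda pi0 q ->
    forall A, measurable A -> q A = p A.

(* Law of the response time of a job that joins a queue in state [s]: the
   remaining size of the head job, [k - 1] waiting jobs and the job itself. *)
Definition response_from (g : R -> R) (s : state) (A : set R) : \bar R :=
  if njobs s is 0%N then sum_sizes g 1 0 A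
  else sum_sizes g (njobs s) (head_size s) A.

(* The entries of [l] of minimal length, with multiplicity. *)
Definition shortest (l : seq state) : seq state :=
  [seq s <- l | all (fun s' => (njobs s <= njobs s')%N) l].

Definition response_law (g : R -> R) (d : nat) (pi0 : R)
    (p : probability state R) (A : set R) : \bar R :=
  ((1 - pi0)%:E * response_from g empty A
   + pi0%:E * iid_expect p d (fun l =>
       ((size (shortest l))%:R^-1)%:E
       * \sum_(s <- shortest l) response_from g s A))%E.

(* [X] is distributed as the response time when the equilibrium is [p]. *)
Definition is_response_time (g : R -> R) (d : nat) (pi0 : R)
    (p : probability state R) (dO : measure_display) (O : measurableType dO)
    (P : probability O R) (X : {RV P >-> measurableTypeR R}) : Prop :=
  forall A : set (measurableTypeR R), measurable A ->
    distribution P X A = response_law g d pi0 p A.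

(* The policy without memory: the memory is always empty. *)
Definition classic_the_equilibrium g d lambda := the_equilibrium g d lambda 1.
Definition classic_is_response_time g d := is_response_time g d 1.

End LoadBalancing.

Notation state R := (nat * measurableTypeR R)%type (only parsing).

(* Main.v *)
(* Let [p] be the equilibrium with memory, [u] its probability of a busy queue, and
   [c = pi0 `^ d^-1].  Let [q] be the mixture [c p + (1 - c) delta_empty], so that
   its tails at lengths [k >= 1] are [c] times those of [p].  The chance of joining a
   queue of length [k >= 1] is homogeneous of degree [d - 1] in the tails, hence [q]
   (without memory, arrival rate [lambda c]) and [p] induce the same arrival rates in
   busy states.  The probability flow out of the empty state is [lambda (1 - pi0 u ^ d)]
   under [p], and [c] times this under [q].  So the two queues differ only in the
   rates [r 0 >= r' 0] at which they leave the empty state, with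
   [c * p(empty) * (r 0 - r' 0) = (1 - c) * r' 0].

   The stationarity of [q] for the slower queue comes from Duhamel's formula.  With
   [P, P'] the two transition functions, [y t := P' t empty A] and [z t] the average
   of [P' t] over the states in which a service of a lone job starts,
     [P t s A + (r 0 - r' 0) (y * P . s empty) t
        <= P' t s A + (r 0 - r' 0) (z * P . s empty) t],
   where [*] is the convolution in time.  Integrating against [p], which is
   stationary for [P], and eliminating [z] with the renewal equation of [y] gives
   [q A <= \int q(ds) P' t s A].  Applied to [A] and to its complement, this is an
   equality because [P' t s] has total mass at most [1].

   By uniqueness [q] is the equilibrium without memory.  Finally, [d] independent
   states of law [q] are all busy with probability [c ^ d = pi0] times that for [p],
   and a job that joins an empty queue has the same response time law in all cases. *)

Require Import Defs.
From HB Require Import structures.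
From mathcomp Require Import all_boot all_order all_algebra.
From mathcomp Require Import all_classical all_reals all_analysis.
From mathcomp Require Import measurable_realfun ring lra.
Import Order.TTheory GRing.Theory Num.Theory.
Import numFieldNormedType.Exports.
Local Open Scope classical_set_scope.
Local Open Scope ring_scope.

(** * Convolution and exponential renewal *)

Section Convolution.
Set Implicit Arguments.
Unset Strict Implicit.
Context {R : realType}.
Local Open Scope ereal_scope.
Local Notation mu := (@lebesgue_measure R).
Local Notation mR := (measurableTypeR R).
Implicit Types (f h k : mR -> \bar R) (a b c t : R).

Lemma measurable_weighted_integral {d} {Y : measurableType d}
    (f k : Y * mR -> \bar R) :
  measurable_fun setT f -> measurable_fun setT k ->
  (forall y, 0 <= f y) -> (forall y, 0 <= k y) ->
  measurable_fun setT (fun y => \int[mu]_b (f (y, b) * k (y, b))).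
Proof.
move=> mf mk f0 k0.
apply: (measurable_fun_fubini_tonelli_F (fun y => f y * k y)).
  exact: emeasurable_funM.
by move=> y; exact: mule_ge0.
Qed.

Lemma weighted_integral_swap {d1 d2} {T1 : measurableType d1} {T2 : measurableType d2}
    (m1 : {sigma_finite_measure set T1 -> \bar R})
    (m2 : {sigma_finite_measure set T2 -> \bar R})
    (f : T1 -> \bar R) (h : T2 -> \bar R) (k : T1 * T2 -> \bar R) :
  measurable_fun setT f -> measurable_fun setT h -> measurable_fun setT k ->
  (forall x, 0 <= f x) -> (forall x, 0 <= h x) -> (forall x, 0 <= k x) ->
  \int[m1]_a (f a * \int[m2]_b (h b * k (a, b))) =
  \int[m2]_b (h b * \int[m1]_a (f a * k (a, b))).
Proof.
move=> mf mh mk f0 h0 k0.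
have mk1 (a : T1) : measurable_fun setT (fun b : T2 => k (a, b)).
  exact: measurableT_comp mk (pair1_measurable a).
have mk2 (b : T2) : measurable_fun setT (fun a : T1 => k (a, b)).
  exact: measurableT_comp mk (pair2_measurable b).
have mG : measurable_fun setT (fun x : T1 * T2 => f x.1 * (h x.2 * k x)).
  apply: emeasurable_funM; first exact: (measurableT_comp mf measurable_fst).
  by apply: emeasurable_funM => //; exact: (measurableT_comp mh measurable_snd).
transitivity (\int[m1]_a \int[m2]_b (f a * (h b * k (a, b)))).
  apply: eq_integral => a _; rewrite ge0_integralZl//.
    by apply: emeasurable_funM => //; exact: mk1.
  by move=> b _; exact: mule_ge0.
rewrite (fubini_tonelli (fun x : T1 * T2 => f x.1 * (h x.2 * k x)))//=; last first.
  by move=> x; rewrite !mule_ge0.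
apply: eq_integral => b _; rewrite -ge0_integralZl//.
- by apply: eq_integral => a _; rewrite muleCA.
- by apply: emeasurable_funM => //; exact: mk2.
- by move=> a _; exact: mule_ge0.
Qed.

Lemma ge0_integral_reflection f t :
  measurable_fun setT f -> (forall x, 0 <= f x) ->
  \int[mu]_x f (t - x)%R = \int[mu]_x f x.
Proof.
move=> mf f0; pose phi (x : mR) : mR := (t - x)%R.
have mphi : measurable_fun setT phi by exact: measurable_funB.
rewrite -[LHS]/(\int[mu]_(x in phi @^-1` setT) (f \o phi) x).
rewrite -(ge0_integral_pushforward mphi mu)//.
(* The image of Lebesgue measure under the reflection gives every interval its length: the preimage
   of []a, b]] is [[t - b, t - a[]. *)
apply: eq_measure_integral => A mA _; apply/esym/lebesgue_measure_unique => //=.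
move=> _ [[a b]] _ <-; rewrite /pushforward.
rewrite [X in _ = mu X](_ : _ = `[(t - b)%R, (t - a)%R[%classic); last first.
  by apply/seteqP; split => x /=; rewrite !in_itv/= /phi => /andP[? ?]; lra.
rewrite !lebesgue_measure_itv/= !lte_fin.
have -> : (t - b < t - a)%R = (a < b)%R by rewrite ltrD2l ltrN2.
by case: ifP => // _; rewrite -!EFinB; congr EFin; ring.
Qed.

(** The integral runs over the whole line; for factors that vanish at negative times it is the usual
    integral over [[0, t]]. *)
Definition conv f h t : \bar R := \int[mu]_b (f b * h (t - b)%R).

Lemma measurable_conv f h :
  measurable_fun setT f -> measurable_fun setT h ->
  (forall x, 0 <= f x) -> (forall x, 0 <= h x) ->
  measurable_fun setT (conv f h : mR -> \bar R).
Proof.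
move=> mf mh f0 h0.
apply: (@measurable_weighted_integral _ mR (fun x => f x.2)
  (fun x => h (x.1 - x.2)%R)) => //.
  exact: (measurableT_comp mf measurable_snd).
by apply: (measurableT_comp mh) => //; exact: measurable_funB.
Qed.

Lemma conv_ge0 f h t : (forall x, 0 <= f x) -> (forall x, 0 <= h x) ->
  0 <= conv f h t.
Proof. by move=> f0 h0; apply: integral_ge0 => b _; exact: mule_ge0. Qed.

Lemma convC f h t :
  measurable_fun setT f -> measurable_fun setT h ->
  (forall x, 0 <= f x) -> (forall x, 0 <= h x) ->
  conv f h t = conv h f t.
Proof.
move=> mf mh f0 h0; rewrite /conv.
rewrite -(@ge0_integral_reflection (fun b => f b * h (t - b)%R) t).
- by apply: eq_integral => b _; rewrite subKr muleC.
- by apply: emeasurable_funM => //; apply: measurableT_comp => //; exact: measurable_funB.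
- by move=> b; exact: mule_ge0.
Qed.

(** Tonelli exchanges two successive delays; this plays the part of associativity below. *)
Lemma conv_leftC f h k t :
  measurable_fun setT f -> measurable_fun setT h -> measurable_fun setT k ->
  (forall x, 0 <= f x) -> (forall x, 0 <= h x) -> (forall x, 0 <= k x) ->
  conv f (conv h k) t = conv h (conv f k) t.
Proof.
move=> mf mh mk f0 h0 k0; rewrite /conv.
have mK : measurable_fun setT (fun x : mR * mR => k (t - x.1 - x.2)%R).
  by apply: (measurableT_comp mk); do 2 apply: measurable_funB => //.
rewrite (weighted_integral_swap _ _ mf mh mK f0 h0 (fun=> k0 _)).
apply: eq_integral => b _; congr (_ * _); apply: eq_integral => a _ /=.
by rewrite addrAC.
Qed.

Lemma convDl f h k t :
  measurable_fun setT f -> measurable_fun setT h -> measurable_fun setT k ->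
  (forall x, 0 <= f x) -> (forall x, 0 <= h x) -> (forall x, 0 <= k x) ->
  conv (f \+ h) k t = conv f k t + conv h k t.
Proof.
move=> mf mh mk f0 h0 k0; rewrite /conv -ge0_integralD//.
- by apply: eq_integral => b _; rewrite ge0_muleDl.
- by move=> b _; exact: mule_ge0.
- by apply: emeasurable_funM => //; apply: measurableT_comp => //; exact: measurable_funB.
- by move=> b _; exact: mule_ge0.
- by apply: emeasurable_funM => //; apply: measurableT_comp => //; exact: measurable_funB.
Qed.

Lemma convDr f h k t :
  measurable_fun setT f -> measurable_fun setT h -> measurable_fun setT k ->
  (forall x, 0 <= f x) -> (forall x, 0 <= h x) -> (forall x, 0 <= k x) ->
  conv f (h \+ k) t = conv f h t + conv f k t.
Proof.
move=> mf mh mk f0 h0 k0; rewrite !(@convC f)//; last 2 first.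
- exact: emeasurable_funD.
- by move=> x; exact: adde_ge0.
exact: convDl.
Qed.

Lemma convZl c f k t :
  (0 <= c)%R -> measurable_fun setT f -> measurable_fun setT k ->
  (forall x, 0 <= f x) -> (forall x, 0 <= k x) ->
  conv (fun x => c%:E * f x) k t = c%:E * conv f k t.
Proof.
move=> c0 mf mk f0 k0; rewrite /conv -ge0_integralZl//.
- by apply: eq_integral => b _; rewrite muleA.
- by apply: emeasurable_funM => //; apply: measurableT_comp => //; exact: measurable_funB.
- by move=> b _; exact: mule_ge0.
Qed.

Lemma convZr c f k t :
  (0 <= c)%R -> measurable_fun setT f -> measurable_fun setT k ->
  (forall x, 0 <= f x) -> (forall x, 0 <= k x) ->
  conv f (fun x => c%:E * k x) t = c%:E * conv f k t.
Proof.
move=> c0 mf mk f0 k0; rewrite !(@convC f)//; last 2 first.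
- exact: measurable_funeM.
- by move=> x; rewrite mule_ge0.
exact: convZl.
Qed.

Lemma conv_linear f h k c e t :
  (0 <= c)%R -> (0 <= e)%R ->
  measurable_fun setT f -> measurable_fun setT h -> measurable_fun setT k ->
  (forall x, 0 <= f x) -> (forall x, 0 <= h x) -> (forall x, 0 <= k x) ->
  conv f (fun x => c%:E * h x + e%:E * k x) t = c%:E * conv f h t + e%:E * conv f k t.
Proof.
move=> c0 e0 mf mh mk f0 h0 k0; rewrite -(convZr t c0 mf mh f0 h0) -(convZr t e0 mf mk f0 k0).
apply: convDr => //; try exact: measurable_funeM.
- by move=> x; rewrite mule_ge0.
- by move=> x; rewrite mule_ge0.
Qed.

(** Survival function of an exponential clock of rate [a], set to 0 before time 0. At rate 0 it is
    the indicator of nonnegative times, so convolving with it integrates up to time [t]. *)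
Definition expt a (t : mR) : \bar R :=
  (if (0 <= t)%R then expR (- (a * t)) else 0%R)%:E.

Lemma expt_ge0 a t : 0 <= expt a t.
Proof. by rewrite /expt lee_fin; case: ifP => // _; exact: expR_ge0. Qed.

Lemma measurable_expt a : measurable_fun setT (expt a).
Proof.
apply/measurable_EFinP; apply: measurable_fun_ifT => //.
  exact: measurable_fun_ler.
by apply: measurableT_comp => //; apply: measurable_funN; exact: measurable_funM.
Qed.

Lemma integral_exp_itv a t : (0 <= t)%R ->
  \int[mu]_b ((a%:E * expt a b) * ((0 <= t - b)%R%:R)%:E) =
  (1 - expR (- (a * t)))%:E.
Proof.
rewrite le_eqVlt => /predU1P[<-|t0].
  (* The fundamental theorem of calculus used below asks for [0 < t]; at [t = 0] the integrand lives
     on the single point 0. *)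
  rewrite mulr0 oppr0 expR0 subrr.
  rewrite (_ : (fun _ => _) = (fun b : mR => a%:E * 1%:E) \_ [set 0%R : mR]).
    by rewrite -integral_mkcond integral_set1.
  apply/funext => b; rewrite patchE; case: ifPn => [|].
    by rewrite inE /= => ->; rewrite /expt subrr lexx mulr0 oppr0 expR0 !mule1.
  rewrite notin_setE/= /expt sub0r oppr_ge0 => b0; case: leP => h1; last by rewrite !mule0 mul0e.
  by case: leP => h2; rewrite ?mule0//; exfalso; apply: b0; apply/eqP; rewrite eq_le h1 h2.
transitivity (\int[mu]_(b in `[0%R, t]) (a * expR (- (a * b)))%:E).
  rewrite [RHS]integral_mkcond; apply: eq_integral => b _; rewrite patchE /expt mem_setE in_itv/=.
  rewrite subr_ge0; case: leP => h1 /=; last by rewrite mule0 mul0e.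
  by case: leP => h2; rewrite /= ?mule1 ?mule0.
have cexp : continuous (fun z : R => expR (- (a * z))).
  move=> z; apply: continuous_comp; last exact: continuous_expR.
  by apply: (@continuousN _ R^o); apply: continuousM => //; exact: cst_continuous.
rewrite (@continuous_FTC2 _ _ (fun x => - expR (- (a * x)))%R _ _ t0).
- by rewrite mulr0 oppr0 expR0 -EFinB; congr EFin; lra.
- apply: continuous_subspaceT => z; apply: cvgM; last exact: cexp.
  exact: cvg_cst.
- split.
  + by move=> z _; exact: ex_derive.
  + by apply/cvg_at_right_filter; apply: cvgN; exact: cexp.
  + by apply/cvg_at_left_filter; apply: cvgN; exact: cexp.
- move=> z _.
  have -> : (fun x => - expR (- (a * x)))%R = (fun x => - expR (- a * x))%R.
    by apply/funext => x; rewrite mulNr.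
  rewrite derive1_comp// derive1N// derive1_id mulN1r derive1_comp// derive1E.
  have /funeqP -> := @derive_expR R.
  by rewrite derive1Ml// derive1_id mulr1 mulrN opprK mulrC mulNr.
Qed.

(** A clock of rate [b] superposes independent clocks of rates [a] and [b - a]. If the first one is
    silent up to [t], either both are, or the other one rings first, at some time [x], and the first
    one stays silent during [t - x]. *)
Lemma expt_split a b t : (a <= b)%R ->
  expt a t = expt b t + (b - a)%:E * conv (expt b) (expt a) t.
Proof.
move=> ab; have ba0 : (0 <= b - a)%R by rewrite subr_ge0.
have [t0|t0] := ltP t 0%R.
  rewrite {1 2}/expt lt_geF// add0e /conv integral0_eq ?mule0// => x _.
  rewrite /expt; case: (leP 0%R x) => x0; last by rewrite mul0e.
  by rewrite lt_geF ?mule0// subr_lt0 (lt_le_trans t0).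
(* Uses [exp (- b x) exp (- a (t - x)) = exp (- a t) exp (- (b - a) x)] for [0 <= x <= t]. *)
have -> : conv (expt b) (expt a) t =
    (expR (- (a * t)))%:E * \int[mu]_x (expt (b - a) x * ((0 <= t - x)%R%:R)%:E).
  rewrite -ge0_integralZl//.
  - apply: eq_integral => x _; rewrite /expt; case: leP => x0; last by rewrite !mul0e mule0.
    case: leP => tx; last by rewrite !mule0.
    by rewrite mule1 -!EFinM -!expRD; congr (expR _)%:E; ring.
  - apply: emeasurable_funM; first exact: measurable_expt.
    apply/measurable_EFinP; apply: measurableT_comp => //.
    by apply: measurable_fun_ler => //; exact: measurable_funB.
  - by move=> x _; rewrite mule_ge0 ?expt_ge0// lee_fin.
rewrite muleCA -ge0_integralZl//; last 2 first.
- apply: emeasurable_funM; first exact: measurable_expt.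
  apply/measurable_EFinP; apply: measurableT_comp => //.
  by apply: measurable_fun_ler => //; exact: measurable_funB.
- by move=> x _; rewrite mule_ge0 ?expt_ge0// lee_fin.
under eq_integral do rewrite muleA.
rewrite integral_exp_itv// /expt t0 -EFinM -EFinD; congr EFin.
rewrite mulrBr mulr1 -expRD.
have -> : (- (a * t) + - ((b - a) * t))%R = (- (b * t))%R by ring.
by rewrite addrC subrK.
Qed.

(** Nonnegativity makes distributivity safe in the extended reals; this regroups the terms produced
    by [expt_split]. *)
Lemma ge0_muleD_exchange (u v d x1 x2 y1 y2 : \bar R) :
  0 <= d -> 0 <= u -> 0 <= v -> 0 <= x1 -> 0 <= x2 -> 0 <= y1 -> 0 <= y2 ->
  u * (x1 + d * x2) + v * (y1 + d * y2) = u * x1 + v * y1 + d * (u * x2 + v * y2).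
Proof.
move=> d0 u0 v0 x10 x20 y10 y20.
rewrite (ge0_muleDr u x10) ?mule_ge0// (ge0_muleDr v y10) ?mule_ge0//.
rewrite (ge0_muleDr d) ?mule_ge0// addeACA.
by rewrite (muleCA u d) (muleCA v d).
Qed.

Section Renewal.
Variables (y z : mR -> \bar R) (phi a b : R).
Hypotheses (ab : (a <= b)%R) (phi0 : (0 <= phi)%R).
Hypotheses (my : measurable_fun setT y) (mz : measurable_fun setT z).
Hypotheses (y0 : forall x, 0 <= y x) (z0 : forall x, 0 <= z x).

Let mEa := measurable_expt a.
Let mEb := measurable_expt b.
Let Ea0 := expt_ge0 a.
Let Eb0 := expt_ge0 b.
Let ba0 : 0 <= (b - a)%:E. Proof. by rewrite lee_fin subr_ge0. Qed.
Let mEE : measurable_fun setT (conv (expt b) (expt a) : mR -> \bar R).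
Proof. exact: measurable_conv. Qed.
Let EE0 t : 0 <= conv (expt b) (expt a) t.
Proof. exact: conv_ge0. Qed.

Let conv_expt_split t :
  conv z (expt a) t = conv z (expt b) t + (b - a)%:E * conv z (conv (expt b) (expt a)) t.
Proof.
have ba0' : (0 <= b - a)%R by rewrite subr_ge0.
rewrite -[X in _ = X + _]mul1e -(conv_linear t ler01 ba0' mz mEb mEE z0 Eb0 EE0).
by congr (conv _ _ _); apply/funext => x; rewrite mul1e; exact: expt_split.
Qed.

(* [expt_split] lets one change the rate of the exponential clock in the renewal
   equation of [y]. *)
Lemma renewal_rate_up t : (0 <= a)%R ->
  (forall t, y t = phi%:E * expt a t + a%:E * conv z (expt a) t) ->
  y t = phi%:E * expt b t + a%:E * conv z (expt b) t + (b - a)%:E * conv y (expt b) t.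
Proof.
move=> a0 yE.
have -> : conv y (expt b) t =
    phi%:E * conv (expt b) (expt a) t + a%:E * conv z (conv (expt b) (expt a)) t.
  have mzE : measurable_fun setT (conv z (expt a) : mR -> \bar R) by exact: measurable_conv.
  have zE0 x : 0 <= conv z (expt a) x by exact: conv_ge0.
  rewrite (convC t my mEb y0 Eb0) (conv_leftC t mz mEb mEa z0 Eb0 Ea0).
  rewrite -(conv_linear t phi0 a0 mEb mEa mzE Eb0 Ea0 zE0).
  by congr (conv _ _ _); apply/funext => x; rewrite yE.
rewrite yE (expt_split t ab) conv_expt_split.
by apply: ge0_muleD_exchange; rewrite ?conv_ge0.
Qed.

(** The change of clock in the other direction. The correction stays on the left, so that no
    possibly infinite value is subtracted. At [a = 0] this is the integrated form of the renewal
    equation. *)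
Lemma renewal_rate_down t : (0 <= b)%R ->
  (forall t, y t = phi%:E * expt b t + b%:E * conv z (expt b) t) ->
  y t + (b - a)%:E * conv y (expt a) t = phi%:E * expt a t + b%:E * conv z (expt a) t.
Proof.
move=> b0 yE.
have -> : conv y (expt a) t =
    phi%:E * conv (expt b) (expt a) t + b%:E * conv z (conv (expt b) (expt a)) t.
  have mzE : measurable_fun setT (conv z (expt b) : mR -> \bar R) by exact: measurable_conv.
  have zE0 x : 0 <= conv z (expt b) x by exact: conv_ge0.
  have -> : conv (expt b) (expt a) = conv (expt a) (expt b).
    by apply/funext => x; exact: convC.
  rewrite (convC t my mEa y0 Ea0) (conv_leftC t mz mEa mEb z0 Ea0 Eb0).
  rewrite -(conv_linear t phi0 b0 mEa mEb mzE Ea0 Eb0 zE0).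
  by congr (conv _ _ _); apply/funext => x; rewrite yE.
rewrite yE (expt_split t ab) conv_expt_split.
by apply/esym/ge0_muleD_exchange; rewrite ?conv_ge0.
Qed.

End Renewal.

End Convolution.

(** * First-event decomposition of the queue *)

Section FirstEvent.
Set Implicit Arguments.
Unset Strict Implicit.
Context {R : realType}.
Local Open Scope ereal_scope.
Local Notation mu := (@lebesgue_measure R).
Local Notation mR := (measurableTypeR R).
Variables (gam : mR -> \bar R) (r : nat -> R).
Hypothesis gam_meas : measurable_fun setT gam.
Hypothesis gam_ge0 : forall v, 0 <= gam v.
Hypothesis gam_fin : forall v, gam v \is a fin_num.
Hypothesis gam_lt0 : forall v, (v < 0)%R -> gam v = 0.
Hypothesis gam_mass : \int[mu]_v gam v = 1.
Hypothesis r_ge0 : forall k, (0 <= r k)%R.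
Implicit Types (X Y : nat -> mR -> mR -> \bar R) (z : mR -> \bar R).

(* [X k t w] is a quantity attached to the time [t] left to run and to the state
   [(k, w)]; it is taken to vanish for [t < 0], which turns the integrals over
   [[0, t]] of the definition of [trans_lt] into convolutions. *)
Definition nnmeas X :=
  (forall k, measurable_fun setT (fun x : mR * mR => X k x.1 x.2)) /\
  (forall k t w, 0 <= X k t w).

Lemma nnmeas_comp {d} {Y : measurableType d} X k (f h : Y -> mR) : nnmeas X ->
  measurable_fun setT f -> measurable_fun setT h ->
  measurable_fun setT (fun y => X k (f y) (h y)).
Proof.
move=> [mX _] mf mh.
exact: (measurableT_comp (mX k) (measurable_fun_pair mf mh)).
Qed.

(** Counterpart of [start_service]; the empty queue carries head size 0. *)
Definition serve X k (t : mR) : \bar R :=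
  if k is 0 then X 0%N t 0%R else \int[mu]_v (gam v * X k t v).

(** Density at [b] of the first arrival time, cut at the completion time [w] of the head job. *)
Definition hazard (a w b : R) : \bar R :=
  (a%:E * expt a b) * ((0 <= w - b)%R%:R)%:E.

(** One step of the conditioning in [trans_lt], as an operator on [X]. The bound [Num.min t w] found
    there is enforced by [hazard] as regards [w], and by the vanishing of [X] at negative times as
    regards [t]. *)
Definition first_event X k (t w : mR) : \bar R :=
  if k is k'.+1 then
    (expR (- (r k * w)))%:E * serve X k' (t - w)%R
    + \int[mu]_b (hazard (r k) w b * X k.+1 (t - b)%R (w - b)%R)
  else conv (fun b => (r 0%N)%:E * expt (r 0%N) b) (serve X 1) t.

Lemma serve_ge0 X k t : nnmeas X -> 0 <= serve X k t.
Proof.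
by case: k => [|k] [_ X0]//=; apply: integral_ge0 => v _; rewrite mule_ge0.
Qed.

Lemma measurable_serve X k : nnmeas X -> measurable_fun setT (serve X k).
Proof.
move=> nX; case: k => [|k] /=; first exact: nnmeas_comp.
apply: (@measurable_weighted_integral _ _ mR (fun x => gam x.2) (fun x => X k.+1 x.1 x.2)) => //.
- exact: (measurableT_comp gam_meas measurable_snd).
- by case: nX.
- by case: nX.
Qed.

Lemma hazard_ge0 a w b : (0 <= a)%R -> 0 <= hazard a w b.
Proof. by move=> a0; rewrite /hazard !mule_ge0 ?expt_ge0// lee_fin. Qed.

Lemma measurable_rexpt (a : R) : measurable_fun setT (fun b => a%:E * expt a b).
Proof. by apply: measurable_funeM; exact: measurable_expt. Qed.

Lemma rexpt_ge0 (a b : R) : (0 <= a)%R -> 0 <= a%:E * expt a b.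
Proof. by move=> a0; rewrite mule_ge0 ?expt_ge0// lee_fin. Qed.

Lemma measurable_hazard a :
  measurable_fun setT (fun x : mR * mR => hazard a x.1 x.2).
Proof.
apply: emeasurable_funM.
  exact: (measurableT_comp (measurable_rexpt a) measurable_snd).
apply/measurable_EFinP; apply: measurableT_comp => //.
by apply: measurable_fun_ler => //; exact: measurable_funB.
Qed.

Lemma measurable_hazard2 a w : measurable_fun setT (hazard a w : mR -> \bar R).
Proof. exact: measurableT_comp (measurable_hazard a) (pair1_measurable w). Qed.

Lemma nnmeas_shift X k t w : nnmeas X ->
  measurable_fun setT (fun b : mR => X k (t - b)%R (w - b)%R).
Proof. by move=> nX; apply: nnmeas_comp => //; exact: measurable_funB. Qed.

Lemma nnmeas_first_event X : nnmeas X -> nnmeas (first_event X).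
Proof.
move=> nX; split => [[|k]|[|k] t w] /=.
- have mC : measurable_fun setT
      (conv (fun b => (r 0%N)%:E * expt (r 0%N) b) (serve X 1) : mR -> \bar R).
    apply: measurable_conv.
    + exact: measurable_rexpt.
    + exact: measurable_serve.
    + by move=> b; exact: rexpt_ge0.
    + by move=> b; exact: serve_ge0.
  exact: (measurableT_comp mC measurable_fst).
- apply: emeasurable_funD.
  + apply: emeasurable_funM.
      apply/measurable_EFinP; apply: measurableT_comp => //.
      by apply: measurable_funN; exact: measurable_funM.
    by apply: (measurableT_comp (measurable_serve k nX)); exact: measurable_funB.
  + apply: (@measurable_weighted_integral _ _ (mR * mR)%type
      (fun x => hazard (r k.+1) x.1.2 x.2)
      (fun x => X k.+2 (x.1.1 - x.2)%R (x.1.2 - x.2)%R)).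
    * exact: (measurableT_comp (measurable_hazard (r k.+1)) (measurable_fun_pair
        (measurableT_comp measurable_snd measurable_fst) measurable_snd)).
    * apply: nnmeas_comp => //; apply: measurable_funB => //.
        exact: (measurableT_comp measurable_fst measurable_fst).
      exact: (measurableT_comp measurable_snd measurable_fst).
    * by move=> x; exact: hazard_ge0.
    * by move=> x; case: nX.
- apply: conv_ge0 => b; first exact: rexpt_ge0.
  exact: serve_ge0.
- apply: adde_ge0; first by rewrite mule_ge0 ?serve_ge0// lee_fin expR_ge0.
  apply: integral_ge0 => b _; rewrite mule_ge0 ?hazard_ge0//.
  by case: nX.
Qed.

Lemma nnmeasD X Y : nnmeas X -> nnmeas Y -> nnmeas (fun k t w => X k t w + Y k t w).
Proof.
move=> [mX X0] [mY Y0]; split; first by move=> k; exact: emeasurable_funD.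
by move=> k t w; rewrite adde_ge0.
Qed.

Lemma nnmeas_conv z X : measurable_fun setT z -> (forall a, 0 <= z a) ->
  nnmeas X -> nnmeas (fun k t w => conv z (fun t' => X k t' w) t).
Proof.
move=> mz z0 nX; split => [k|k t w]; last first.
  by apply: conv_ge0 => // a; case: nX.
apply: (@measurable_weighted_integral _ _ (mR * mR)%type
  (fun x => z x.2) (fun x => X k (x.1.1 - x.2)%R x.1.2)) => //.
- exact: (measurableT_comp mz measurable_snd).
- apply: nnmeas_comp => //.
    apply: measurable_funB => //.
    exact: (measurableT_comp measurable_fst measurable_fst).
  exact: (measurableT_comp measurable_snd measurable_fst).
- by move=> x; case: nX.
Qed.

Lemma serveD X Y k t : nnmeas X -> nnmeas Y ->
  serve (fun k t w => X k t w + Y k t w) k t = serve X k t + serve Y k t.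
Proof.
move=> nX nY; case: k => [//|k] /=; rewrite -ge0_integralD//.
- by apply: eq_integral => v _; rewrite ge0_muleDr//; [case: nX|case: nY].
- by move=> v _; rewrite mule_ge0//; case: nX.
- by apply: emeasurable_funM => //; exact: nnmeas_comp.
- by move=> v _; rewrite mule_ge0//; case: nY.
- by apply: emeasurable_funM => //; exact: nnmeas_comp.
Qed.

Lemma first_eventD X Y k t w : nnmeas X -> nnmeas Y ->
  first_event (fun k t w => X k t w + Y k t w) k t w =
  first_event X k t w + first_event Y k t w.
Proof.
move=> nX nY; have X0 := nX.2; have Y0 := nY.2; case: k => [|k] /=.
  rewrite -convDr.
  - by congr (conv _ _ _); apply/funext => a; exact: serveD.
  - exact: measurable_rexpt.
  - exact: measurable_serve.
  - exact: measurable_serve.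
  - by move=> b; exact: rexpt_ge0.
  - by move=> b; exact: serve_ge0.
  - by move=> b; exact: serve_ge0.
rewrite serveD// ge0_muleDr ?serve_ge0//.
rewrite [in RHS]addeACA -ge0_integralD//.
- by congr (_ + _); apply: eq_integral => b _; rewrite ge0_muleDr.
- by move=> b _; rewrite mule_ge0// hazard_ge0.
- by apply: emeasurable_funM; [exact: measurable_hazard2|exact: nnmeas_shift].
- by move=> b _; rewrite mule_ge0// hazard_ge0.
- by apply: emeasurable_funM; [exact: measurable_hazard2|exact: nnmeas_shift].
Qed.

Lemma le_serve X Y k t : nnmeas X -> nnmeas Y ->
  (forall k t w, (0 <= w)%R -> X k t w <= Y k t w) -> serve X k t <= serve Y k t.
Proof.
move=> nX nY XY; case: k => [|k] /=; first exact: XY.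
apply: ge0_le_integral => //.
- by move=> v _; rewrite mule_ge0//; case: nX.
- by apply: emeasurable_funM => //; exact: nnmeas_comp.
- by apply: emeasurable_funM => //; exact: nnmeas_comp.
- move=> v _; have [v0|v0] := ltP v 0%R; first by rewrite gam_lt0// !mul0e.
  by rewrite lee_wpmul2l// XY.
Qed.

(** A comparison at [0 <= w] is enough, because [hazard] cuts arrivals after [w] and [gam] vanishes
    at negative sizes. The mass bounds below are only available there: for negative [w] the factor
    [expR (- (r k * w))] may exceed 1. *)
Lemma le_first_event X Y k t w : nnmeas X -> nnmeas Y ->
  (forall k t w, (0 <= w)%R -> X k t w <= Y k t w) ->
  first_event X k t w <= first_event Y k t w.
Proof.
move=> nX nY XY; case: k => [|k] /=.
  apply: ge0_le_integral => //.
  - by move=> b _; rewrite mule_ge0 ?rexpt_ge0 ?serve_ge0.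
  - apply: emeasurable_funM; first exact: measurable_rexpt.
    by apply: (measurableT_comp (measurable_serve 1 nX)); exact: measurable_funB.
  - apply: emeasurable_funM; first exact: measurable_rexpt.
    by apply: (measurableT_comp (measurable_serve 1 nY)); exact: measurable_funB.
  - by move=> b _; rewrite lee_wpmul2l ?rexpt_ge0//; exact: le_serve.
apply: leeD.
  by rewrite lee_wpmul2l ?lee_fin ?expR_ge0//; exact: le_serve.
apply: ge0_le_integral => //.
- by move=> b _; rewrite mule_ge0 ?hazard_ge0//; case: nX.
- by apply: emeasurable_funM; [exact: measurable_hazard2|exact: nnmeas_shift].
- by apply: emeasurable_funM; [exact: measurable_hazard2|exact: nnmeas_shift].
- move=> b _; rewrite /hazard; case: (leP 0%R (w - b)%R) => wb; last by rewrite !mule0 !mul0e.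
  by rewrite lee_wpmul2l ?XY// mule1 rexpt_ge0.
Qed.

Lemma serve_conv z X k t : measurable_fun setT z -> (forall a, 0 <= z a) ->
  nnmeas X ->
  serve (fun k t w => conv z (fun t' => X k t' w) t) k t = conv z (serve X k) t.
Proof.
move=> mz z0 nX; case: k => [//|k] /=.
have mK : measurable_fun setT (fun x : mR * mR => X k.+1 (t - x.2)%R x.1).
  by apply: nnmeas_comp => //; exact: measurable_funB.
exact: (weighted_integral_swap _ _ gam_meas mz mK gam_ge0 z0 (fun=> nX.2 _ _ _)).
Qed.

(** The operator acts on time by shifts only, so it commutes with a convolution in time. *)
Lemma conv_first_event z X k t w : measurable_fun setT z -> (forall a, 0 <= z a) ->
  nnmeas X ->
  conv z (fun t => first_event X k t w) t =
  first_event (fun k t w => conv z (fun t' => X k t' w) t) k t w.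
Proof.
move=> mz z0 nX; have X0 := nX.2; case: k => [|k] /=.
  have -> : serve (fun k t w => conv z (fun t' => X k t' w) t) 1 = conv z (serve X 1).
    by apply/funext => a; exact: serve_conv.
  apply: conv_leftC => //.
  - exact: measurable_rexpt.
  - exact: measurable_serve.
  - by move=> b; exact: rexpt_ge0.
  - by move=> b; exact: serve_ge0.
rewrite serve_conv//.
have mS : measurable_fun setT (fun a : mR => serve X k (a - w)%R).
  by apply: (measurableT_comp (measurable_serve k nX)); exact: measurable_funB.
have mK : measurable_fun setT (fun x : mR * mR => X k.+2 (t - x.1 - x.2)%R (w - x.2)%R).
  by apply: nnmeas_comp => //; repeat apply: measurable_funB => //.
pose F1 t : \bar R := (expR (- (r k.+1 * w)))%:E * serve X k (t - w)%R.
pose F2 t : \bar R := \int[mu]_b (hazard (r k.+1) w b * X k.+2 (t - b)%R (w - b)%R).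
transitivity (conv z F1 t + conv z F2 t).
  apply: convDr => //.
  - exact: measurable_funeM.
  - apply: (@measurable_weighted_integral _ _ mR (fun x => hazard (r k.+1) w x.2)
      (fun x => X k.+2 (x.1 - x.2)%R (w - x.2)%R)).
    + exact: (measurableT_comp (measurable_hazard2 _ _) measurable_snd).
    + by apply: nnmeas_comp => //; exact: measurable_funB.
    + by move=> x; exact: hazard_ge0.
    + by move=> x; case: nX.
  - by move=> x; rewrite mule_ge0 ?serve_ge0// lee_fin expR_ge0.
  - by move=> x; apply: integral_ge0 => b _; rewrite mule_ge0 ?hazard_ge0.
congr (_ + _).
  have -> : conv z F1 t = (expR (- (r k.+1 * w)))%:E * conv z (fun t => serve X k (t - w)%R) t.
    by apply: convZr => // x; exact: serve_ge0.
  have -> // : conv z (fun t => serve X k (t - w)%R) t = conv z (serve X k) (t - w)%R.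
  by apply: eq_integral => a _; rewrite addrAC.
have := weighted_integral_swap mu mu mz (measurable_hazard2 (r k.+1) w) mK z0
  (fun=> hazard_ge0 _ _ (r_ge0 _)) (fun=> X0 _ _ _).
rewrite /conv /F2 => /= ->; apply: eq_integral => b _; congr (_ * _).
by apply: eq_integral => a _; rewrite addrAC.
Qed.

Lemma cvg_integral_nondecreasing {d} {T : measurableType d}
    (m : {measure set T -> \bar R}) (f_ : nat -> T -> \bar R) (f : T -> \bar R) :
  (forall n, measurable_fun setT (f_ n)) -> (forall n x, 0 <= f_ n x) ->
  (forall x, nondecreasing_seq (f_ ^~ x)) ->
  (forall x, f_ n x @[n --> \oo] --> f x) ->
  \int[m]_x f_ n x @[n --> \oo] --> \int[m]_x f x.
Proof.
move=> mf f0 ndf cf.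
rewrite (_ : f = fun x => limn (f_ ^~ x)); last first.
  by apply/funext => x; apply/esym/cvg_lim => //; exact: cf.
by apply: cvg_monotone_convergence => // x _; exact: ndf.
Qed.

Lemma cvg_serve (X_ : nat -> nat -> mR -> mR -> \bar R) X k t :
  (forall n, nnmeas (X_ n)) ->
  (forall k t w, nondecreasing_seq (fun n => X_ n k t w)) ->
  (forall k t w, X_ n k t w @[n --> \oo] --> X k t w) ->
  serve (X_ n) k t @[n --> \oo] --> serve X k t.
Proof.
move=> nX ndX cX; case: k => [|k] /=; first exact: cX.
apply: cvg_integral_nondecreasing.
- by move=> n; apply: emeasurable_funM => //; exact: nnmeas_comp.
- by move=> n v; rewrite mule_ge0//; case: (nX n).
- by move=> v m n mn; rewrite lee_wpmul2l//; exact: ndX.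
- by move=> v; exact: cvgeZl.
Qed.

Lemma cvg_first_event (X_ : nat -> nat -> mR -> mR -> \bar R) X k t w :
  (forall n, nnmeas (X_ n)) -> nnmeas X ->
  (forall k t w, nondecreasing_seq (fun n => X_ n k t w)) ->
  (forall k t w, X_ n k t w @[n --> \oo] --> X k t w) ->
  first_event (X_ n) k t w @[n --> \oo] --> first_event X k t w.
Proof.
move=> nX nX' ndX cX; have X_ge0 n := (nX n).2; case: k => [|k] /=.
  apply: cvg_integral_nondecreasing.
  - move=> n; apply: emeasurable_funM; first exact: measurable_rexpt.
    by apply: (measurableT_comp (measurable_serve 1 (nX n))); exact: measurable_funB.
  - by move=> n b; rewrite mule_ge0 ?rexpt_ge0 ?serve_ge0.
  - move=> b m n mn; rewrite lee_wpmul2l ?rexpt_ge0//.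
    by apply: le_serve => // *; exact: ndX.
  - by move=> b; apply: cvgeZl; [rewrite /expt -EFinM|exact: cvg_serve].
apply: cvgeD.
- apply: ge0_adde_def; rewrite inE.
    by rewrite mule_ge0 ?lee_fin ?expR_ge0 ?serve_ge0.
  by apply: integral_ge0 => b _; rewrite mule_ge0 ?hazard_ge0//; case: nX'.
- by apply: cvgeZl => //; exact: cvg_serve.
apply: cvg_integral_nondecreasing.
- by move=> n; apply: emeasurable_funM; [exact: measurable_hazard2|exact: nnmeas_shift].
- by move=> n b; rewrite mule_ge0 ?hazard_ge0.
- by move=> b m n mn; rewrite lee_wpmul2l ?hazard_ge0//; exact: ndX.
- by move=> b; apply: cvgeZl => //; rewrite /hazard /expt -!EFinM.
Qed.


(** * Iteration of the first-event equation for a terminal payoff *)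

Section Queue.
Variable f : nat -> mR -> R.
Hypothesis f_meas : forall k, measurable_fun setT (f k).
Hypothesis f_ge0 : forall k w, (0 <= f k w)%R.

(** Contribution of the paths without event up to time [t], with payoff [f] at the final state. *)
Definition no_event (f : nat -> mR -> R) k (t w : mR) : \bar R :=
  if k is 0 then (f 0%N 0%R)%:E * expt (r 0%N) t
  else (if (0 <= t < w)%R then expR (- (r k * t)) * f k (w - t) else 0)%:E.

Lemma nnmeas_no_event : nnmeas (no_event f).
Proof.
split => [[|k]|[|k] t w] /=.
- apply: measurable_funeM; exact: (measurableT_comp (measurable_expt _) measurable_fst).
- apply/measurable_EFinP; apply: measurable_fun_ifT => //.
    by apply: measurable_and; [exact: measurable_fun_ler|exact: measurable_fun_ltr].
  apply: measurable_funM.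
    apply: measurableT_comp => //; apply: measurable_funN.
    by apply: measurable_funM.
  by apply: (measurableT_comp (f_meas _)); exact: measurable_funB.
- by rewrite mule_ge0 ?expt_ge0 ?lee_fin.
- by rewrite lee_fin; case: ifP => // _; rewrite mulr_ge0 ?expR_ge0.
Qed.

(** [trans_lt] with a payoff [f] instead of the indicator of [A], and with integrals over the whole
    line. *)
Fixpoint queue_lt n : nat -> mR -> mR -> \bar R :=
  if n is n'.+1 then
    fun k t w => no_event f k t w + first_event (queue_lt n') k t w
  else fun _ _ _ => 0.

Lemma nnmeas_queue_lt n : nnmeas (queue_lt n).
Proof.
elim: n => [|n IH]; first by split => // k; exact: measurable_cst.
by apply: nnmeasD; [exact: nnmeas_no_event|exact: nnmeas_first_event].
Qed.

Lemma nondecreasing_queue_lt k t w : nondecreasing_seq (fun n => queue_lt n k t w).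
Proof.
apply/nondecreasing_seqP => n; elim: n k t w => [|n IH] k t w.
  exact: (nnmeas_queue_lt 1).2.
rewrite leeD2l//; apply: le_first_event.
- exact: nnmeas_queue_lt.
- exact: (nnmeas_queue_lt n.+1).
- by move=> *; exact: IH.
Qed.

Definition queue k t w := ereal_sup (range (fun n => queue_lt n k t w)).

Lemma cvg_queue k t w : queue_lt n k t w @[n --> \oo] --> queue k t w.
Proof. exact/ereal_nondecreasing_cvgn/nondecreasing_queue_lt. Qed.

Lemma nnmeas_queue : nnmeas queue.
Proof.
split => [k|k t w].
  apply: (emeasurable_fun_cvg (fun n (x : mR * mR) => queue_lt n k x.1 x.2)) => //.
    by move=> n; case: (nnmeas_queue_lt n).
  by move=> x _; exact: cvg_queue.
by apply: ereal_sup_ubound; exists 0%N.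
Qed.

(** The iterates increase, so monotone convergence carries the recursion to the limit. *)
Lemma queueE k t w : queue k t w = no_event f k t w + first_event queue k t w.
Proof.
have : queue_lt n.+1 k t w @[n --> \oo] --> queue k t w.
  by rewrite (cvg_shiftS (fun n => queue_lt n k t w)); exact: cvg_queue.
move/cvg_lim => <- //; apply/cvg_lim => //.
apply: cvgeD; [|exact: cvg_cst|].
  apply: ge0_adde_def; rewrite inE; first exact: nnmeas_no_event.2.
  exact: (nnmeas_first_event nnmeas_queue).2.
apply: cvg_first_event.
- exact: nnmeas_queue_lt.
- exact: nnmeas_queue.
- exact: nondecreasing_queue_lt.
- exact: cvg_queue.
Qed.

End Queue.

(** Full mass at nonnegative times: for [0 <= w] it solves the first-event equation with payoff 1,
    and it serves as an upper barrier for the iterates. *)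
Definition alive (_ : nat) (t _ : mR) : \bar R := ((0 <= t)%R%:R)%:E.

Lemma nnmeas_alive : nnmeas alive.
Proof.
split=> [k|k t w]; last by rewrite lee_fin.
by apply/measurable_EFinP; apply: measurableT_comp => //; exact: measurable_fun_ler.
Qed.

Lemma serve_alive k t : serve alive k t = ((0 <= t)%R%:R)%:E.
Proof.
case: k => [//|k] /=; under eq_integral do rewrite muleC.
by rewrite ge0_integralZl ?gam_mass ?mule1// lee_fin.
Qed.

Lemma integral_rexpt_alive a t :
  \int[mu]_b ((a%:E * expt a b) * ((0 <= t - b)%R%:R)%:E) =
  (if (0 <= t)%R then 1 - expR (- (a * t)) else 0)%:E.
Proof.
case: leP => t0; first exact: integral_exp_itv.
rewrite integral0_eq// => b _; rewrite /expt; case: (leP 0%R b) => b0; last by rewrite mule0 mul0e.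
by rewrite lt_geF ?mule0// subr_lt0 (lt_le_trans t0).
Qed.

Lemma first_event_alive k t w : (0 <= w)%R ->
  no_event (fun _ _ => 1%R) k t w + first_event alive k t w = alive k t w.
Proof.
move=> w0; case: k => [|k] /=.
  rewrite mul1e /conv; under eq_integral do rewrite serve_alive.
  rewrite integral_rexpt_alive /expt /alive; case: leP => t0; last by rewrite adde0.
  by rewrite -EFinD addrC subrK.
rewrite serve_alive.
(* The cutoffs at [t] and at [w] combine into a single one at [Num.min t w]. *)
have -> : \int[mu]_b (hazard (r k.+1) w b * alive k.+2 (t - b)%R (w - b)%R) =
    \int[mu]_b ((r k.+1)%:E * expt (r k.+1) b * ((0 <= Num.min t w - b)%R%:R)%:E).
  apply: eq_integral => b _; rewrite /hazard /alive -muleA -EFinM -natrM mulnb.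
  by rewrite !subr_ge0 le_min andbC.
rewrite integral_rexpt_alive le_min w0 andbT /alive subr_ge0 mulr1.
case: (leP 0%R t) => t0; last by rewrite lt_geF ?(lt_le_trans t0)//= mule0 !adde0.
case: (ltP t w) => tw /=; first by rewrite mulr0n mule0 add0e -EFinD addrC subrK.
by rewrite add0e mule1 -EFinD addrC subrK.
Qed.

(** Induction against [alive]: the payoffs sum to at most 1, and [first_event] is additive and
    monotone. *)
Lemma queue_lt_add_le (f h : nat -> mR -> R) n k t w :
  (forall k, measurable_fun setT (f k)) -> (forall k, measurable_fun setT (h k)) ->
  (forall k w, (0 <= f k w)%R) -> (forall k w, (0 <= h k w)%R) ->
  (forall k w, (f k w + h k w <= 1)%R) -> (0 <= w)%R ->
  queue_lt f n k t w + queue_lt h n k t w <= ((0 <= t)%R%:R)%:E.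
Proof.
move=> mf mh f0 h0 fh w0; elim: n k t w w0 => [|n IH] k t w w0.
  by rewrite adde0 lee_fin.
have nf := nnmeas_queue_lt mf f0 n; have nh := nnmeas_queue_lt mh h0 n.
rewrite -[leRHS]/(alive k t w) -first_event_alive//= addeACA leeD//.
  case: k => [|k] /=.
    rewrite -muleDl ?adde_defNN// mul1e.
    by rewrite -[leRHS]mul1e lee_wpmul2r ?expt_ge0// -EFinD lee_fin.
  rewrite -EFinD lee_fin; case: ifP => _; last by rewrite addr0.
  by rewrite -mulrDr ler_wpM2l ?expR_ge0.
rewrite -first_eventD//; apply: le_first_event => //.
- exact: nnmeasD.
- exact: nnmeas_alive.
Qed.

Lemma queue_lt_neg (f : nat -> mR -> R) n k t w :
  (forall k, measurable_fun setT (f k)) -> (forall k w, (0 <= f k w <= 1)%R) ->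
  (0 <= w)%R -> (t < 0)%R -> queue_lt f n k t w = 0.
Proof.
move=> mf f01 w0 t0; have f0 k' w' : (0 <= f k' w')%R by case/andP: (f01 k' w').
apply/eqP; rewrite eq_le (nnmeas_queue_lt mf f0 n).2 andbT.
have : queue_lt f n k t w + queue_lt (fun _ _ => 0%R) n k t w <= ((0 <= t)%R%:R)%:E.
  by apply: queue_lt_add_le => // k' w'; rewrite addr0; case/andP: (f01 k' w').
by rewrite (lt_geF t0); apply: le_trans; rewrite leeDl// (nnmeas_queue_lt _ _ n).2.
Qed.

Lemma queue_add_le (f h : nat -> mR -> R) k t w :
  (forall k, measurable_fun setT (f k)) -> (forall k, measurable_fun setT (h k)) ->
  (forall k w, (0 <= f k w)%R) -> (forall k w, (0 <= h k w)%R) ->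
  (forall k w, (f k w + h k w <= 1)%R) -> (0 <= w)%R ->
  queue f k t w + queue h k t w <= ((0 <= t)%R%:R)%:E.
Proof.
move=> mf mh f0 h0 fh w0.
have cvgD : queue_lt f n k t w + queue_lt h n k t w @[n --> \oo] --> queue f k t w + queue h k t w.
  apply: cvgeD; [|exact: cvg_queue..].
  by apply: ge0_adde_def; rewrite inE; apply: (nnmeas_queue _ _).2.
by apply: (cvge_to_le cvgD); apply: nearW => n; exact: queue_lt_add_le.
Qed.

End FirstEvent.

(** * Changing the arrival rate of the empty queue *)

Section RateChange.
Set Implicit Arguments.
Unset Strict Implicit.
Context {R : realType}.
Local Open Scope ereal_scope.
Local Notation mu := (@lebesgue_measure R).
Local Notation mR := (measurableTypeR R).
Variables (gam : mR -> \bar R).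
Hypothesis gam_meas : measurable_fun setT gam.
Hypothesis gam_ge0 : forall v, 0 <= gam v.
Hypothesis gam_fin : forall v, gam v \is a fin_num.
Hypothesis gam_lt0 : forall v, (v < 0)%R -> gam v = 0.
Hypothesis gam_mass : \int[mu]_v gam v = 1.
Variables (r r' : nat -> R).
Hypothesis r_ge0 : forall k, (0 <= r k)%R.
Hypothesis r'_ge0 : forall k, (0 <= r' k)%R.
Hypothesis eq_rate : forall k, r k.+1 = r' k.+1.
Hypothesis le_rate0 : (r' 0%N <= r 0%N)%R.

Definition idle (k : nat) (_ : mR) : R := (k == 0%N)%:R.

Lemma measurable_idle k : measurable_fun setT (idle k).
Proof. exact: measurable_cst. Qed.

Lemma idle_ge0 k w : (0 <= idle k w)%R.
Proof. by rewrite /idle. Qed.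

Lemma measurable_nat_prod {d} {Y : measurableType d} (F : nat -> Y -> \bar R) :
  (forall k, measurable_fun setT (F k)) ->
  measurable_fun setT (fun s : nat * Y => F s.1 s.2).
Proof.
move=> mF _ B mB; rewrite setTI.
rewrite (_ : _ @^-1` B = \bigcup_k ([set k] `*` (F k @^-1` B))).
  apply: bigcup_measurable => k _; apply: measurableX => //.
  by rewrite -[X in measurable X]setTI; exact: mF.
apply/seteqP; split => [[k y]/= By|[k y] [i _ [/= -> ]]//].
by exists k.
Qed.

(** Add [c] times the inequality to [e] times the equation: since [c d = e a], the terms in [u2] are
    absorbed, and the finite term in [u1] cancels. *)
Lemma ge0_exchange_cancel (c e a d : R) (I1 I2 x1 x2 u1 u2 : \bar R) :
  (0 <= c)%R -> (0 <= e)%R -> (0 <= a)%R -> (0 <= d)%R ->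
  0 <= I1 -> 0 <= I2 -> 0 <= x1 -> 0 <= x2 -> 0 <= u1 -> 0 <= u2 ->
  u1 \is a fin_num -> (c * d = e * a)%R ->
  I1 + d%:E * u1 <= I2 + d%:E * u2 -> x2 + a%:E * u1 = x1 + a%:E * u2 ->
  c%:E * I1 + e%:E * x1 <= c%:E * I2 + e%:E * x2.
Proof.
move=> c0 e0 a0 d0 I10 I20 x10 x20 u10 u20 u1fin cd le12 eq12.
have au i : 0 <= i -> 0 <= a%:E * i by move=> i0; rewrite mule_ge0.
have du i : 0 <= i -> 0 <= d%:E * i by move=> i0; rewrite mule_ge0.
have swap u : e%:E * (a%:E * u) = c%:E * (d%:E * u) by rewrite !muleA -!EFinM cd.
have fin : e%:E * (a%:E * u1) \is a fin_num by rewrite !fin_numM.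
rewrite -(leeD2rE _ _ fin) -[leRHS]addeA -(ge0_muleDr e%:E x20 (au _ u10)) eq12.
rewrite (ge0_muleDr e%:E x10 (au _ u20)) !swap addeAC (addeC (e%:E * x1)) [leRHS]addeA.
rewrite -(ge0_muleDr c%:E I10 (du _ u10)) -(ge0_muleDr c%:E I20 (du _ u20)).
by rewrite leeD2r// lee_wpmul2l// lee_fin.
Qed.

Variable f : nat -> mR -> R.
Hypothesis f_meas : forall k, measurable_fun setT (f k).
Hypothesis f01 : forall k w, (0 <= f k w <= 1)%R.
Let f_ge0 k w : (0 <= f k w)%R. Proof. by case/andP: (f01 k w). Qed.

Local Notation Q rate h := (queue gam rate h).
Local Notation Qlt rate h := (queue_lt gam rate h).
Let y t : \bar R := Q r' f 0%N t 0%R.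
Let z : mR -> \bar R := serve gam (Q r' f) 1.
Let delta : R := (r 0%N - r' 0%N)%R.
Let delta_ge0 : (0 <= delta)%R. Proof. by rewrite subr_ge0. Qed.
Let phi : R := f 0%N 0%R.

Let nnQ (rate : nat -> R) (h : nat -> mR -> R) : (forall k, 0 <= rate k)%R ->
  (forall k, measurable_fun setT (h k)) -> (forall k w, 0 <= h k w)%R ->
  nnmeas (Q rate h).
Proof. by move=> *; exact: nnmeas_queue. Qed.

Let QE k t w : Q r' f k t w = no_event r' f k t w + first_event gam r' (Q r' f) k t w.
Proof. exact: queueE. Qed.

Let nnQ'f : nnmeas (Q r' f). Proof. exact: nnQ. Qed.

Lemma measurable_idle_value : measurable_fun setT (y : mR -> \bar R).
Proof. exact: nnmeas_comp. Qed.

Lemma idle_value_ge0 t : 0 <= y t. Proof. exact: nnQ'f.2. Qed.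

Lemma measurable_busy_value : measurable_fun setT z.
Proof. exact: measurable_serve. Qed.

Lemma busy_value_ge0 t : 0 <= z t.
Proof. exact: serve_ge0. Qed.

Let my := measurable_idle_value.
Let mz := measurable_busy_value.
Let y0 := idle_value_ge0.
Let z0 := busy_value_ge0.

(** An empty queue waits for a clock of rate [r' 0] and then serves a lone job. This is the renewal
    equation whose clock is changed below. *)
Let idle_valueE t w :
  Q r' f 0%N t w = phi%:E * expt (r' 0%N) t + (r' 0%N)%:E * conv z (expt (r' 0%N)) t.
Proof.
have mE := @measurable_expt R (r' 0%N); have E0 := @expt_ge0 R (r' 0%N).
rewrite QE /=; congr (_ + _).
by rewrite (convZl t (r'_ge0 0) mE mz E0 z0) (convC t mE mz E0 z0).
Qed.

Let measurable_scale (x : mR -> \bar R) :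
  measurable_fun setT x -> measurable_fun setT (fun a => delta%:E * x a).
Proof. exact: measurable_funeM. Qed.

Let scale_ge0 (x : mR -> \bar R) : (forall a, 0 <= x a) ->
  forall a, 0 <= delta%:E * x a.
Proof. by move=> x0 a; rewrite mule_ge0. Qed.

Let dy a : \bar R := delta%:E * y a.
Let dz a : \bar R := delta%:E * z a.
Let mdy : measurable_fun setT (dy : mR -> \bar R). Proof. exact: measurable_scale. Qed.
Let mdz : measurable_fun setT (dz : mR -> \bar R). Proof. exact: measurable_scale. Qed.
Let dy0 a : 0 <= dy a. Proof. exact: scale_ge0. Qed.
Let dz0 a : 0 <= dz a. Proof. exact: scale_ge0. Qed.

(* First-event equation of the slower queue [r'], read with the rates [r] of the
   faster one. *)
Let slow_first_event k t w :
  no_event r f k t w + conv dy (fun t' => no_event r idle k t' w) t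
    + first_event gam r (Q r' f) k t w =
  Q r' f k t w + conv dz (fun t' => no_event r idle k t' w) t.
Proof.
(* In a busy state the two rates agree and the payoff [idle] is 0, so only the equation of [Q r' f]
   remains. *)
case: k => [|k]; last first.
  have E x : no_event r idle k.+1 x w = 0 by rewrite /= /idle mulr0 if_same.
  have C0 (x : mR -> \bar R) : conv x (fun t' => no_event r idle k.+1 t' w) t = 0.
    by apply: integral0_eq => a _; rewrite E mule0.
  by rewrite !C0 !adde0 QE /= eq_rate.
have mE := @measurable_expt R (r 0%N).
have E0 := @expt_ge0 R (r 0%N).
have -> : (fun t' => no_event r idle 0 t' w) = expt (r 0%N).
  by apply/funext => x /=; rewrite mul1e.
rewrite (convZl t delta_ge0 my mE y0 E0) (convZl t delta_ge0 mz mE z0 E0).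
have -> : Q r' f 0%N t w = y t by rewrite /y !idle_valueE.
(* The clock of rate [r' 0] is replaced by one of rate [r 0]; the surplus [delta] accounts for the
   convolutions with [dy] and [dz]. *)
rewrite (@renewal_rate_up R y z phi (r' 0%N) (r 0%N) le_rate0 (f_ge0 _ _) my mz y0 z0 t
  (r'_ge0 0%N) (idle_valueE^~ 0%R)).
rewrite /= (convZl t (r_ge0 0) mE mz E0 z0) (convC t mE mz E0 z0).
have -> : (r 0%N)%:E = (r' 0%N)%:E + delta%:E by rewrite -EFinD /delta addrC subrK.
rewrite ge0_muleDl ?lee_fin//.
by rewrite -!addeA; congr (_ + _); rewrite addeCA; congr (_ + _); rewrite addeCA.
Qed.

Let nn_idle n : nnmeas (Qlt r idle n).
Proof. by apply: nnmeas_queue_lt; [..|exact: measurable_idle|exact: idle_ge0]. Qed.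

Let nn_no_idle : nnmeas (no_event r idle).
Proof. by apply: nnmeas_no_event; [exact: measurable_idle|exact: idle_ge0]. Qed.

Let conv_idle_ltS x n k t w : measurable_fun setT x -> (forall a, 0 <= x a) ->
  conv x (fun t' => Qlt r idle n.+1 k t' w) t =
  conv x (fun t' => no_event r idle k t' w) t +
  first_event gam r (fun k t w => conv x (fun t' => Qlt r idle n k t' w) t) k t w.
Proof.
move=> mx x0; rewrite -conv_first_event//.
have nF : nnmeas (first_event gam r (Qlt r idle n)) by exact: nnmeas_first_event.
apply: convDr => //.
- by apply: nnmeas_comp => //; exact: measurable_cst.
- by apply: nnmeas_comp => //; exact: measurable_cst.
- by move=> a; exact: nn_no_idle.2.
- by move=> a; exact: nF.2.
Qed.

(** Induction on the number of events of the faster queue. By [slow_first_event] the right side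
    obeys the same recursion as the left one; the inequality arises at [n = 0], where the left side
    is 0. *)
Let duhamel_lt n k t w :
  Qlt r f n k t w + conv dy (fun t' => Qlt r idle n k t' w) t <=
  Q r' f k t w + conv dz (fun t' => Qlt r idle n k t' w) t.
Proof.
elim: n k t w => [|n IH] k t w.
  have C0 (x : mR -> \bar R) : conv x (fun t' => Qlt r idle 0 k t' w) t = 0.
    by apply: integral0_eq => a _; rewrite mule0.
  by rewrite !C0 !adde0; exact: nnQ'f.2.
have nf : nnmeas (Qlt r f n) by exact: nnmeas_queue_lt.
have ny := nnmeas_conv mdy dy0 (nn_idle n); have nz := nnmeas_conv mdz dz0 (nn_idle n).
have FD X Y : nnmeas X -> nnmeas Y ->
    first_event gam r X k t w + first_event gam r Y k t w =
    first_event gam r (fun k t w => X k t w + Y k t w) k t w.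
  by move=> nX nY; rewrite first_eventD.
rewrite (conv_idle_ltS n k t w mdy dy0) (conv_idle_ltS n k t w mdz dz0).
rewrite -[Qlt r f n.+1 k t w]/(no_event r f k t w + first_event gam r (Qlt r f n) k t w).
rewrite addeACA (FD _ _ nf ny) [leRHS]addeA -(slow_first_event k t w).
rewrite -[leRHS]addeA (FD _ _ nnQ'f nz).
apply: leeD2l.
apply: (le_first_event gam_meas gam_ge0 gam_lt0 r_ge0 k t w (nnmeasD nf ny) (nnmeasD nnQ'f nz)).
by move=> i u v _; exact: IH.
Qed.

Let nnQ_idle : nnmeas (Q r idle).
Proof. by apply: nnQ; [..|exact: measurable_idle|exact: idle_ge0]. Qed.

Lemma queue_le1 (rate : nat -> R) (h : nat -> mR -> R) k t w :
  (forall k, 0 <= rate k)%R -> (forall k, measurable_fun setT (h k)) ->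
  (forall k w, 0 <= h k w <= 1)%R -> (0 <= w)%R ->
  Q rate h k t w <= ((0 <= t)%R%:R)%:E.
Proof.
move=> rate0 mh h01 w0; have h0 i v : (0 <= h i v)%R by case/andP: (h01 i v).
have : Q rate h k t w + Q rate (fun _ _ => 0%R) k t w <= ((0 <= t)%R%:R)%:E.
  by apply: queue_add_le => // i v; rewrite addr0; case/andP: (h01 i v).
by apply: le_trans; rewrite leeDl//; apply: (nnmeas_queue _ _ _ _ _ _).2.
Qed.

Let dy_fin a : dy a \is a fin_num.
Proof.
rewrite fin_numM// ge0_fin_numE//.
by apply: (le_lt_trans (queue_le1 _ _ _ _ _ _)) => //; rewrite ltry.
Qed.

(* Duhamel's formula, of which only this inequality is needed. *)
Lemma queue_idle_exchange k t w :
  Q r f k t w + conv dy (fun t' => Q r idle k t' w) t <=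
  Q r' f k t w + conv dz (fun t' => Q r idle k t' w) t.
Proof.
have sec h : nnmeas h -> measurable_fun setT (fun b : mR => h k (t - b)%R w).
  by move=> nh; apply: nnmeas_comp => //; exact: measurable_funB.
have cvgl : Qlt r f n k t w + conv dy (fun t' => Qlt r idle n k t' w) t @[n --> \oo] -->
    Q r f k t w + conv dy (fun t' => Q r idle k t' w) t.
  apply: cvgeD.
  - apply: ge0_adde_def; rewrite inE.
      exact: (nnQ _ _ _).2.
    by apply: conv_ge0 => // a; exact: nnQ_idle.2.
  - exact: cvg_queue.
  - apply: cvg_integral_nondecreasing.
    + by move=> n; apply: emeasurable_funM => //; exact: sec.
    + by move=> n a; rewrite mule_ge0//; exact: (nn_idle n).2.
    + move=> a m n mn; rewrite lee_wpmul2l//.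
      exact: (nondecreasing_queue_lt gam_meas gam_ge0 gam_lt0 r_ge0 measurable_idle idle_ge0).
    + move=> a; apply: cvgeZl => //.
      exact: (cvg_queue gam_meas gam_ge0 gam_lt0 r_ge0 measurable_idle idle_ge0).
(* The limit is taken on the left only; on the right each truncated convolution is bounded by the
   full one. *)
apply: (cvge_to_le cvgl); apply: nearW => n.
apply: (le_trans (duhamel_lt n k t w)); rewrite leeD2l//.
apply: ge0_le_integral => //.
- by move=> a _; rewrite mule_ge0//; exact: (nn_idle n).2.
- by apply: emeasurable_funM => //; exact: sec.
- by apply: emeasurable_funM => //; exact: sec.
- by move=> a _; rewrite lee_wpmul2l//; apply: ereal_sup_ubound; exists n.
Qed.

Variables (p : probability (nat * mR)%type R) (p0 : R).
Hypothesis p_neg : p [set s | (s.2 < 0)%R] = 0.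
Hypothesis p_stationary : forall t, (0 <= t)%R ->
  \int[p]_s Q r f s.1 t s.2 = \int[p]_s (f s.1 s.2)%:E.
Hypothesis p_idle : forall t, (0 <= t)%R -> \int[p]_s Q r idle s.1 t s.2 = p0%:E.
Hypothesis p0_ge0 : (0 <= p0)%R.

Lemma measurable_nnmeas_state X t : nnmeas X ->
  measurable_fun setT (fun s : nat * mR => X s.1 t s.2).
Proof.
move=> nX.
exact: (@measurable_nat_prod _ mR (fun k w => X k t w)
  (fun k => nnmeas_comp k nX (measurable_cst t) (@measurable_id _ mR setT))).
Qed.

Lemma measurable_neg_head : measurable [set s : nat * mR | (s.2 < 0)%R].
Proof.
have := @measurable_fun_ltr _ _ R setT (fun s : nat * mR => s.2) (cst 0%R).
move=> /(_ measurable_snd (measurable_cst _) measurableT).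
move=> /(_ [set true] (I : measurable [set true])).
by rewrite setTI; congr measurable; apply/seteqP; split => s.
Qed.

(** Under the stationary [p] the probability of an empty queue is constant in time. At negative
    times the integrand vanishes outside the null set of negative head sizes. *)
Let integral_queue_idle t : \int[p]_s Q r idle s.1 t s.2 = p0%:E * expt 0%R t.
Proof.
rewrite /expt; case: leP => t0; first by rewrite p_idle// mul0r oppr0 expR0 mule1.
rewrite mule0 -(@integral0 _ _ R p setT); apply: ge0_ae_eq_integral => //.
- exact: measurable_nnmeas_state.
- by move=> s _; exact: nnQ_idle.2.
- exists [set s | (s.2 < 0)%R]; split => //; first exact: measurable_neg_head.
  move=> s /= neq; rewrite ltNge; apply/negP => s0; apply: neq => _.
  apply/eqP; rewrite eq_le nnQ_idle.2 andbT.
  have := @queue_le1 r idle s.1 t s.2 r_ge0 (@measurable_idle) _ s0.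
  by rewrite (lt_geF t0); apply => k w; rewrite /idle ler0n lern1 leq_b1.
Qed.

Let integral_conv_idle x t : measurable_fun setT x -> (forall a, 0 <= x a) ->
  \int[p]_s conv x (fun t' => Q r idle s.1 t' s.2) t = p0%:E * conv x (expt 0%R) t.
Proof.
move=> mx x0.
have mE := @measurable_expt R 0%R; have E0 := @expt_ge0 R 0%R.
rewrite -(convZr t p0_ge0 mx mE x0 E0).
have mK : measurable_fun setT (fun u : (nat * mR) * mR => Q r idle u.1.1 (t - u.2)%R u.1.2).
  have mQ : measurable_fun setT (fun v : nat * (mR * mR) => Q r idle v.1 v.2.1 v.2.2).
    exact: (@measurable_nat_prod _ (mR * mR)%type (fun k u => Q r idle k u.1 u.2) nnQ_idle.1).
  have m11 : measurable_fun setT (fun u : (nat * mR) * mR => u.1.1).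
    exact: (measurableT_comp measurable_fst measurable_fst).
  have m12 : measurable_fun setT (fun u : (nat * mR) * mR => u.1.2).
    exact: (measurableT_comp measurable_snd measurable_fst).
  have m2 : measurable_fun setT (fun u : (nat * mR) * mR => (t - u.2)%R).
    by apply: measurable_funB.
  exact: (measurableT_comp mQ (measurable_fun_pair m11 (measurable_fun_pair m2 m12))).
have := weighted_integral_swap p mu (measurable_cst 1%E) mx mK
  (fun=> lee01) x0 (fun=> nnQ_idle.2 _ _ _).
under eq_integral do rewrite mul1e.
move=> /= ->; apply: eq_integral => a _; congr (_ * _).
by under eq_integral do rewrite mul1e; rewrite integral_queue_idle.
Qed.

(** Since [y] is at most 1 and vanishes at negative times, the integral is at most the length of
    [[0, t]]. This is the term to be cancelled in the next lemma. *)
Let conv_value_fin t : conv y (expt 0%R) t \is a fin_num.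
Proof.
rewrite ge0_fin_numE; last by apply: conv_ge0 => // a; exact: expt_ge0.
apply: (@le_lt_trans _ _ (\int[mu]_(a in `[0%R, t]) cst 1%E a)); last first.
  rewrite integral_cst//= mul1e lebesgue_measure_itv/=; case: ifP => _; rewrite ?ltry//.
rewrite [leRHS]integral_mkcond; apply: ge0_le_integral => //.
- by move=> a _; rewrite mule_ge0 ?expt_ge0.
- apply: emeasurable_funM => //; apply: (measurableT_comp (measurable_expt _)).
  exact: measurable_funB.
- by apply/(measurable_restrictT _ _).1 => //; exact: measurable_cst.
move=> a _; rewrite patchE mem_setE in_itv/=.
have := @queue_le1 r' f 0%N a 0%R r'_ge0 f_meas f01 (lexx _); rewrite -/(y a).
rewrite /expt subr_ge0; case: (leP 0%R a) => a0 /= ya; last first.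
  by rewrite (_ : y a = 0) ?mul0e//; apply/eqP; rewrite eq_le ya y0.
by case: ifP => _; rewrite ?mule0// mul0r oppr0 expR0 mule1.
Qed.

(** Integrating [queue_idle_exchange] against [p] turns the value of the faster queue into the mean
    payoff and the probability of being empty into [p0]. The renewal equation with its clock lowered
    to rate 0 then removes [z], the weights matching by the balance of rates. *)
Lemma idle_rate_superinvariant c t : (0 <= c <= 1)%R -> (0 <= t)%R ->
  (c * p0 * (r 0%N - r' 0%N) = (1 - c) * r' 0%N)%R ->
  c%:E * (\int[p]_s (f s.1 s.2)%:E) + (1 - c)%:E * phi%:E <=
  c%:E * (\int[p]_s Q r' f s.1 t s.2) + (1 - c)%:E * Q r' f 0%N t 0%R.
Proof.
move=> /andP[c0 c1] t0 cE.
have c1' : (0 <= 1 - c)%R by rewrite subr_ge0.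
have mE := @measurable_expt R 0%R; have E0 := @expt_ge0 R 0%R.
have mC x : measurable_fun setT x -> (forall a, 0 <= x a) ->
    measurable_fun setT (fun s : nat * mR => conv x (fun t' => Q r idle s.1 t' s.2) t).
  move=> mx x0.
  apply: (@measurable_nnmeas_state (fun k t w => conv x (fun t' => Q r idle k t' w) t)).
  exact: nnmeas_conv.
have C0 x : (forall a, 0 <= x a) -> forall s : nat * mR,
    0 <= conv x (fun t' => Q r idle s.1 t' s.2) t.
  by move=> x0 s; apply: conv_ge0 => // a; exact: nnQ_idle.2.
have nnQrf : nnmeas (Q r f) by exact: nnQ.
have main : \int[p]_s (f s.1 s.2)%:E + p0%:E * conv dy (expt 0%R) t <=
    \int[p]_s Q r' f s.1 t s.2 + p0%:E * conv dz (expt 0%R) t.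
  have intD (u v : nat * mR -> \bar R) : measurable_fun setT u -> measurable_fun setT v ->
      (forall s, 0 <= u s) -> (forall s, 0 <= v s) ->
      \int[p]_s u s + \int[p]_s v s = \int[p]_s (u s + v s).
    by move=> mu_ mv u0 v0; rewrite ge0_integralD.
  have mr := measurable_nnmeas_state t nnQrf; have mr' := measurable_nnmeas_state t nnQ'f.
  rewrite -(integral_conv_idle t mdy dy0) -(integral_conv_idle t mdz dz0) -(p_stationary t0).
  pose U h (s : nat * mR) := h s.1 t s.2 : \bar R.
  pose V x (s : nat * mR) := conv x (fun t' => Q r idle s.1 t' s.2) t.
  rewrite [leLHS](intD (U (Q r f)) (V dy) mr (mC dy mdy dy0)
    (fun s => nnQrf.2 s.1 t s.2) (C0 dy dy0)).
  rewrite [leRHS](intD (U (Q r' f)) (V dz) mr' (mC dz mdz dz0)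
    (fun s => nnQ'f.2 s.1 t s.2) (C0 dz dz0)).
  apply: ge0_le_integral => //.
  - by move=> s _; apply: adde_ge0; [exact: nnQrf.2|exact: (C0 dy dy0)].
  - exact: (emeasurable_funD mr (mC _ mdy dy0)).
  - exact: (emeasurable_funD mr' (mC _ mdz dz0)).
  - by move=> s _; exact: queue_idle_exchange.
move: main; rewrite (convZl t delta_ge0 my mE y0 E0) (convZl t delta_ge0 mz mE z0 E0).
have := @renewal_rate_down R y z phi 0%R (r' 0%N) (r'_ge0 0) (f_ge0 _ _) my mz y0 z0 t (r'_ge0 0).
rewrite subr0 => /(_ (fun t => idle_valueE t 0%R)).
rewrite [X in phi%:E * X]/expt t0 mul0r oppr0 expR0 mule1.
have := conv_value_fin t.
have : 0 <= conv z (expt 0%R) t by apply: conv_ge0.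
set Cy := conv y _ _; set Cz := conv z _ _; set If := \int[p]_s (f _ _)%:E.
set IF := \int[p]_s _ => Cz0 fCy yE main.
have Cy0 : 0 <= Cy by exact: conv_ge0.
have If0 : 0 <= If by apply: integral_ge0 => s _; rewrite lee_fin.
have IF0 : 0 <= IF by apply: integral_ge0 => s _; exact: nnQ'f.2.
(* The balance enters as [c (p0 delta) = (1 - c) r' 0]; [Cz] is eliminated and the finite [Cy]
   cancelled. *)
apply: (@ge0_exchange_cancel c (1 - c) (r' 0%N) (p0 * delta) If IF _ _ Cy Cz) => //.
- by rewrite mulr_ge0.
- by rewrite lee_fin; exact: f_ge0.
- exact: nnQ'f.2.
- by rewrite mulrA cE.
- by rewrite EFinM -!muleA.
Qed.

End RateChange.

(** * The transition function of the model in first-event form *)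

Section TransitionFunction.
Set Implicit Arguments.
Unset Strict Implicit.
Context {R : realType}.
Local Open Scope ereal_scope.
Local Notation mu := (@lebesgue_measure R).
Local Notation mR := (measurableTypeR R).
Local Notation Rpos := (`]0%R, +oo[%classic : set mR).
Variables (g : R -> R) (m : R).
Hypothesis g_density : job_size_density g m.
Implicit Types (A : set (nat * mR)).

(** Extended by 0, so that averages over job sizes are integrals over the whole line. *)
Definition size_density (v : mR) : \bar R := ((g \_ Rpos) v)%:E.

Lemma size_densityE v : size_density v = if (0 < v)%R then (g v)%:E else 0.
Proof. by rewrite /size_density patchE mem_setE in_itv/= andbT; case: ifP. Qed.

Lemma measurable_size_density : measurable_fun setT size_density.
Proof.
apply/measurable_EFinP/(measurable_restrictT _ _).1 => //.
exact: density_measurable g_density.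
Qed.

Lemma size_density_ge0 v : 0 <= size_density v.
Proof.
rewrite size_densityE; case: ifP => // v0.
by rewrite lee_fin; exact: (density_ge0 g_density).
Qed.

Lemma size_density_fin v : size_density v \is a fin_num.
Proof. by []. Qed.

Lemma size_density_lt0 v : (v < 0)%R -> size_density v = 0.
Proof. by move=> v0; rewrite size_densityE ltNge ltW. Qed.

Lemma job_expectE (h : R -> \bar R) : job_expect g h = \int[mu]_v (size_density v * h v).
Proof.
rewrite /job_expect integral_mkcond; apply: eq_integral => v _.
rewrite patchE size_densityE mem_setE in_itv/= andbT.
by case: ifP => //; rewrite mul0e.
Qed.

Lemma size_density_mass : \int[mu]_v size_density v = 1.
Proof.
rewrite -(density_mass g_density) [RHS]integral_mkcond; apply: eq_integral => v _.
by rewrite patchE size_densityE mem_setE in_itv/= andbT.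
Qed.

Let gam_m := measurable_size_density.
Let gam_0 := size_density_ge0.
Let gam_n := size_density_lt0.
Let gam_1 := size_density_mass.

Definition state_indic A (k : nat) (w : mR) : R := \1_A (k, w).

Lemma measurable_state_indic A : measurable A ->
  forall k, measurable_fun setT (state_indic A k).
Proof.
move=> mA k; have mI := @measurable_indic _ _ R setT A mA.
exact: measurableT_comp mI (pair1_measurable k).
Qed.

Lemma state_indic01 A k w : (0 <= state_indic A k w <= 1)%R.
Proof. by rewrite /state_indic indicE ler0n lern1 leq_b1. Qed.

Lemma state_indic_ge0 A k w : (0 <= state_indic A k w)%R.
Proof. by case/andP: (state_indic01 A k w). Qed.

Variable r : nat -> R.
Hypothesis r_ge0 : forall k, (0 <= r k)%R.

Lemma serve_queue_lt_neg A n k t : measurable A -> (t < 0)%R ->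
  serve size_density (queue_lt size_density r (state_indic A) n) k t = 0.
Proof.
move=> mA t0.
have Q0 i w : (0 <= w)%R -> queue_lt size_density r (state_indic A) n i t w = 0.
  move=> w0; apply: queue_lt_neg => //; [exact: measurable_state_indic|exact: state_indic01].
case: k => [|k] /=; first exact: Q0.
apply: integral0_eq => v _; have [v0|v0] := ltP v 0%R; first by rewrite gam_n ?mul0e.
by rewrite Q0 ?mule0.
Qed.

(** Integrals over bounded intervals become integrals over the line, because [queue_lt] is 0 at
    negative times and nonnegative head sizes. *)
Lemma trans_ltE n t k w A : (0 <= t)%R -> measurable A ->
  trans_lt g r n t (k, w) A = queue_lt size_density r (state_indic A) n k t w.
Proof.
move=> + mA; elim: n k t w => [//|n IH] [|k] t w t0 /=.
  congr (_ + _); first by rewrite /expt t0 muleC -EFinM.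
  rewrite integral_mkcond; apply: eq_integral => a _; rewrite patchE mem_setE in_itv/=.
  rewrite /expt; case: (leP 0%R a) => a0; last by rewrite mule0 mul0e.
  case: (leP a t) => at_ /=; last first.
    have ta : (t - a < 0)%R by rewrite subr_lt0.
    by have /= -> := serve_queue_lt_neg n 1 mA ta; rewrite mule0.
  rewrite -EFinM; congr (_ * _); rewrite job_expectE; apply: eq_integral => v _.
  by rewrite IH// subr_ge0.
rewrite t0/= [RHS]addeA; congr (_ + _).
  case: ltP => tw.
    have tw' : (t - w < 0)%R by rewrite subr_lt0.
    by have -> := serve_queue_lt_neg n k mA tw'; rewrite mule0 adde0.
  rewrite add0e; congr (_ * _); case: k => [|k] /=; first by rewrite IH// subr_ge0.
  by rewrite job_expectE; apply: eq_integral => v _; rewrite IH// subr_ge0.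
rewrite integral_mkcond; apply: eq_integral => a _; rewrite patchE mem_setE in_itv/=.
rewrite /hazard /expt subr_ge0 le_min; case: (leP 0%R a) => a0; last by rewrite mule0 !mul0e.
case: (leP a w) => aw /=; last by rewrite andbF mule0 mul0e.
rewrite andbT mule1; case: (leP a t) => at_.
  by rewrite IH ?subr_ge0.
rewrite (queue_lt_neg gam_m gam_0 gam_n gam_1 r_ge0) ?mule0 ?subr_ge0 ?subr_lt0//.
- exact: measurable_state_indic.
- exact: state_indic01.
Qed.

Lemma transE t s A : (0 <= t)%R -> measurable A ->
  trans g r t s A = queue size_density r (state_indic A) s.1 t s.2.
Proof.
move=> t0 mA; case: s => k w; congr ereal_sup.
by apply/seteqP; split => _ [n _ <-]; exists n => //=; rewrite trans_ltE.
Qed.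

Lemma nnmeas_trans A : measurable A ->
  nnmeas (queue size_density r (state_indic A)).
Proof.
move=> mA; exact: (nnmeas_queue gam_m gam_0 gam_n r_ge0
  (measurable_state_indic mA) (@state_indic_ge0 A)).
Qed.

Lemma measurable_trans t A : (0 <= t)%R -> measurable A ->
  measurable_fun setT (fun s : nat * mR => trans g r t s A).
Proof.
move=> t0 mA; rewrite (_ : (fun s => _) =
    fun s => queue size_density r (state_indic A) s.1 t s.2); last first.
  by apply/funext => s; exact: transE.
exact: (measurable_nnmeas_state t (nnmeas_trans mA)).
Qed.

Lemma trans_ge0 t s A : (0 <= t)%R -> measurable A -> 0 <= trans g r t s A.
Proof. by move=> t0 mA; rewrite transE//; exact: (nnmeas_trans mA).2. Qed.

Lemma trans_add_setC_le1 t s A : (0 <= t)%R -> measurable A -> (0 <= s.2)%R ->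
  trans g r t s A + trans g r t s (~` A) <= 1.
Proof.
move=> t0 mA s0; rewrite !transE//; last exact: measurableC.
have := queue_add_le gam_m gam_0 gam_n gam_1 r_ge0 s.1 t
  (measurable_state_indic mA) (measurable_state_indic (measurableC mA))
  (@state_indic_ge0 A) (@state_indic_ge0 (~` A)) _ s0.
rewrite t0; apply => k w; rewrite /state_indic !indicE in_setC.
by case: (_ \in A); rewrite /= ?addr0 ?add0r.
Qed.

End TransitionFunction.

(** * Mixtures with the empty state *)

Section IdleMixture.
Set Implicit Arguments.
Unset Strict Implicit.
Context {R : realType}.
Local Open Scope ereal_scope.
Local Notation mu := (@lebesgue_measure R).
Local Notation mR := (measurableTypeR R).
Local Notation state := (nat * mR)%type.
Implicit Types (p q : probability state R) (A : set state) (c : R).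

(** The relation [q = c p + (1 - c) delta_empty], put in terms of integrals so that it applies
    directly to transition functions and to iterated expectations. *)
Definition idle_mixture c p q := forall F : state -> \bar R,
  measurable_fun setT F -> (forall s, 0 <= F s) ->
  \int[q]_s F s = c%:E * \int[p]_s F s + (1 - c)%:E * F empty.

Lemma idle_mixture_exists c p : (0 <= c <= 1)%R -> exists q, idle_mixture c p q.
Proof.
move=> /andP[c0 c1]; have c1' : (0 <= 1 - c)%R by rewrite subr_ge0.
pose m : {measure set state -> \bar R} :=
  measure_add (mscale (NngNum c0) p) (mscale (NngNum c1') (\d_(empty : state))).
have m1 : m setT = 1.
  transitivity (mscale (NngNum c0) p setT + mscale (NngNum c1') (\d_(empty : state)) setT).
    exact: measure_addE.
  by rewrite /mscale/= probability_setT diracT !mule1 -EFinD addrC subrK.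
(* The mass is already 1; normalizing only supplies the structure of a probability. *)
have qE A : mnormalize m p A = m A.
  by rewrite /mnormalize m1 onee_eq0/= invr1 mule1.
exists (mnormalize m p) => F mF F0.
rewrite (eq_measure_integral m) => [|A _ _]; last exact: qE.
rewrite ge0_integral_measure_add// !ge0_integral_mscale//=.
by rewrite integral_dirac// diracT mul1e.
Qed.

Lemma measurable_njobs (k : nat) : measurable [set s : state | njobs s = k].
Proof.
rewrite (_ : [set _ | _] = [set k] `*` setT); first exact: measurableX.
by apply/seteqP; split => s //= [].
Qed.

Lemma measurable_valid_state : measurable (valid_state : set state).
Proof.
rewrite (_ : valid_state = [set empty] `|`
  ([set k | (0 < k)%N] `*` `]0%R, +oo[%classic)); last first.
  by apply/seteqP; split => s /=; rewrite /valid_state/= in_itv/= andbT.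
apply: measurableU; last by apply: measurableX.
rewrite (_ : [set empty] = [set 0%N] `*` [set 0%R]).
  by apply: measurableX => //; exact: measurable_set1.
by apply/seteqP; split => [_ -> //|[k w] /= [-> ->]].
Qed.

Lemma integral_state_indic p A : measurable A ->
  \int[p]_s (state_indic A s.1 s.2)%:E = p A.
Proof.
move=> mA; rewrite -[in RHS](setIT A) -integral_indic//.
by apply: eq_integral => -[k w] _.
Qed.

Lemma idle_mixtureE c p q A : measurable A -> idle_mixture c p q ->
  q A = c%:E * p A + (1 - c)%:E * (\1_A empty)%:E.
Proof.
move=> mA qE; rewrite -!integral_state_indic// qE//.
  apply/measurable_EFinP; have mI := @measurable_indic _ _ R setT A mA.
  by rewrite (_ : (fun s => _) = \1_A)//; apply/funext => -[].
by move=> s; rewrite lee_fin state_indic_ge0.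
Qed.

Lemma valid_head_ge0 p : p (~` valid_state) = 0 -> p [set s | (s.2 < 0)%R] = 0.
Proof.
move=> p_valid; apply: (subset_measure0 _ _ _ p_valid).
- exact: measurable_neg_head.
- by apply: measurableC; exact: measurable_valid_state.
- by move=> s /= s0 [sE|[_ /(lt_trans s0)]]; [move: s0; rewrite sE ltxx|rewrite ltxx].
Qed.

(** * Stationarity of the mixture for the slower queue *)

Section Stationary.
Variables (g : R -> R) (m : R).
Hypothesis g_density : job_size_density g m.
Variables (r r' : nat -> R).
Hypothesis r_ge0 : forall k, (0 <= r k)%R.
Hypothesis r'_ge0 : forall k, (0 <= r' k)%R.
Hypothesis eq_rate : forall k, r k.+1 = r' k.+1.
Hypothesis le_rate0 : (r' 0%N <= r 0%N)%R.
Variables (p q : probability state R) (c : R).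
Hypothesis c01 : (0 <= c <= 1)%R.
Hypothesis p_valid : p (~` valid_state) = 0.
Hypothesis p_stationary : stationary g r p.
Hypothesis q_mix : idle_mixture c p q.
Let p0 : R := fine (p [set s | njobs s = 0%N]).
Hypothesis rate_balance : (c * p0 * (r 0%N - r' 0%N) = (1 - c) * r' 0%N)%R.

Let gam_m := measurable_size_density g_density.
Let gam_0 := size_density_ge0 g_density.
Let gam_f := @size_density_fin R g.
Let gam_n := @size_density_lt0 R g.
Let gam_1 := size_density_mass g_density.

Let superinvariant t A : (0 <= t)%R -> measurable A ->
  q A <= \int[q]_s trans g r' t s A.
Proof.
move=> t0 mA; rewrite (idle_mixtureE mA q_mix).
rewrite (q_mix (measurable_trans g_density r'_ge0 t0 mA)); last first.
  by move=> s; exact: (trans_ge0 g_density).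
(* Hence stationarity of [p] on the event of having no job is the constancy required for the payoff
   [idle]. *)
have idleE : @state_indic R [set s | njobs s = 0%N] = idle.
  apply/funext => k; apply/funext => w; rewrite /state_indic /idle indicE.
  have -> // : ((k, w) \in [set s : state | njobs s = 0%N]) = (k == 0%N).
  by apply/idP/eqP => [|k0]; rewrite inE.
under eq_integral do rewrite (transE g_density r'_ge0 _ t0 mA).
rewrite (transE g_density r'_ge0 _ t0 mA) -(integral_state_indic p mA).
apply: (idle_rate_superinvariant gam_m gam_0 gam_f gam_n gam_1 r_ge0 r'_ge0 eq_rate
  le_rate0 (measurable_state_indic mA) (@state_indic01 R A) (valid_head_ge0 p_valid)
  _ _ _ c01 t0 rate_balance).
- move=> u u0; under eq_integral do rewrite -(transE g_density r_ge0 _ u0 mA).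
  by rewrite p_stationary// integral_state_indic.
- move=> u u0; rewrite -idleE.
  have mI := measurable_njobs 0.
  under eq_integral do rewrite -(transE g_density r_ge0 _ u0 mI).
  by rewrite p_stationary// fineK// fin_num_measure.
- exact: fine_ge0.
Qed.

Let mass_le1 t A : (0 <= t)%R -> measurable A ->
  \int[q]_s trans g r' t s A + \int[q]_s trans g r' t s (~` A) <= 1.
Proof.
move=> t0 mA; have mCA := measurableC mA.
have mT := measurable_trans g_density r'_ge0 t0 mA.
have mTC := measurable_trans g_density r'_ge0 t0 mCA.
have T0 s := trans_ge0 g_density r'_ge0 s t0 mA.
have TC0 s := trans_ge0 g_density r'_ge0 s t0 mCA.
rewrite -ge0_integralD// q_mix//; last 2 first.
- exact: emeasurable_funD.
- by move=> s; rewrite adde_ge0.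
case/andP: c01 => c0 c1; have c1' : (0 <= 1 - c)%R by rewrite subr_ge0.
rewrite [leRHS](_ : 1 = c%:E * 1 + (1 - c)%:E * 1); last by rewrite !mule1 -EFinD addrC subrK.
apply: leeD; rewrite lee_wpmul2l ?lee_fin//; last first.
  exact: (trans_add_setC_le1 g_density).
rewrite -[leRHS](_ : \int[p]_s cst 1 s = 1); last first.
  by rewrite integral_cst// mul1e; exact: probability_setT.
(* The mass bound holds at nonnegative head sizes, that is, [p]-almost everywhere. *)
apply: ae_ge0_le_integral => //.
- by move=> s _; rewrite adde_ge0.
- exact: emeasurable_funD.
- exists [set s | (s.2 < 0)%R]; split.
  + exact: measurable_neg_head.
  + exact: valid_head_ge0.
  + move=> s /= nle; rewrite ltNge; apply/negP => s0; apply: nle => _.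
    exact: (trans_add_setC_le1 g_density).
Qed.

Lemma stationary_idle_mixture : stationary g r' q.
Proof.
move=> t A t0 mA; have mCA := measurableC mA.
have T0 : 0 <= \int[q]_s trans g r' t s A.
  by apply: integral_ge0 => s _; exact: (trans_ge0 g_density).
have TC0 : 0 <= \int[q]_s trans g r' t s (~` A).
  by apply: integral_ge0 => s _; exact: (trans_ge0 g_density).
have := mass_le1 t0 mA; have := superinvariant t0 mA; have := superinvariant t0 mCA.
rewrite probability_setC//.
move: T0 TC0; set I1 := \int[q]_s _; set I2 := \int[q]_s _ => I10 I20.
have : q A \is a fin_num by exact: fin_num_measure.
move: (q A) => [a| |]// _.
(* The bounds [q A <= I1], [1 - q A <= I2] and [I1 + I2 <= 1] exclude infinite values and force
   [I1 = q A]. *)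
move: I1 I10 I2 I20 => [x| |] I10 [y| |] I20 //=; rewrite -?EFinB -?EFinD ?lee_fin//.
move=> ay ax xy; congr EFin; lra.
Qed.

End Stationary.

(** * Positivity of the probability of the empty state *)

Section IdleProbability.
Variables (g : R -> R) (m : R).
Hypothesis g_density : job_size_density g m.
Variable r : nat -> R.
Hypothesis r_ge0 : forall k, (0 <= r k)%R.

Let gam := @size_density R g.
Let gam_m := measurable_size_density g_density.
Let gam_0 := size_density_ge0 g_density.
Let gam_n := @size_density_lt0 R g.
Let gam_1 := size_density_mass g_density.

(** The total mass 1 is the increasing limit of the masses beyond [1 / (n + 1)], which therefore
    cannot all vanish. *)
Lemma job_size_away_from0 : exists2 eta : R, (0 < eta)%R &
  0 < \int[mu]_v (gam v * ((eta < v)%R%:R)%:E).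
Proof.
apply: contrapT => none.
pose F n (v : mR) := gam v * ((n.+1%:R^-1 < v)%R%:R)%:E.
have F0 n : \int[mu]_v F n v = 0.
  apply/eqP; rewrite eq_le integral_ge0 ?andbT; last first.
    by move=> v _; apply: mule_ge0; [exact: gam_0|rewrite lee_fin].
  by rewrite leNgt; apply/negP => ?; apply: none; exists (n.+1%:R^-1)%R.
have : \int[mu]_v F n v @[n --> \oo] --> \int[mu]_v gam v.
  apply: cvg_integral_nondecreasing.
  - move=> n; apply: emeasurable_funM => //; apply/measurable_EFinP.
    by apply: measurableT_comp => //; exact: measurable_fun_ltr.
  - by move=> n v; apply: mule_ge0; [exact: gam_0|rewrite lee_fin].
  - move=> v i j ij; rewrite lee_wpmul2l// lee_fin ler_nat.
    case: (ltP (i.+1%:R^-1)%R v) => // iv.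
    by rewrite (le_lt_trans _ iv)// lef_pV2 ?posrE// ler_nat.
  - move=> v; have [v0|v0] := leP v 0%R.
      have -> : gam v = 0 by rewrite /gam size_densityE ltNge v0.
      rewrite (_ : (fun _ => _) = cst 0); first exact: cvg_cst.
      by apply/funext => n; rewrite /F /gam size_densityE ltNge v0 mul0e.
    apply: cvg_near_cst; near=> n.
    have -> : F n v = gam v; last by [].
    rewrite /F (_ : (n.+1%:R^-1 < v)%R = true) ?mule1//.
    near: n; exact: near_infty_natSinv_lt (PosNum v0).
rewrite gam_1 (_ : (fun n => _) = cst 0); last by apply/funext => n; rewrite F0.
move/cvg_lim => /(_ (@ereal_hausdorff R)); rewrite lim_cst// => /eqP.
by rewrite eq_sym onee_eq0.
Unshelve. all: by end_near. Qed.

(** With positive probability no job arrives up to [t], the head job leaves at time [w], and the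
    next job, if any, is larger than [eta] and so still in service after the remaining
    [t - w <= eta]. *)
Lemma trans_service_gt0 eta k t (w : R) : (0 < eta)%R ->
  0 < \int[mu]_v (gam v * ((eta < v)%R%:R)%:E) ->
  (0 <= t)%R -> (t - eta <= w <= t)%R ->
  0 < trans g r t (k.+1, w) [set s : state | njobs s = k].
Proof.
move=> eta0 eta_mass t0 /andP[w1 w2]; have mA := measurable_njobs k.
rewrite (transE g_density r_ge0 _ t0 mA)/=.
set f := state_indic _.
have mf := measurable_state_indic mA; have f0 := @state_indic_ge0 R [set s | njobs s = k].
have nq n : nnmeas (queue_lt gam r f n) by exact: nnmeas_queue_lt.
(* Fewer than 2 events: the completion at time [w] is the only one. *)
apply: (@lt_le_trans _ _ (queue_lt gam r f 2 k.+1 t w)); last first.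
  by apply: ereal_sup_ubound; exists 2%N.
have tw : (0 <= t - w)%R by rewrite subr_ge0.
have serve_gt0 : 0 < serve gam (queue_lt gam r f 1) k (t - w)%R.
  have fk v : f k v = 1%R by rewrite /f /state_indic indicE mem_set.
  have q1 v : no_event r f k (t - w)%R v <= queue_lt gam r f 1 k (t - w)%R v.
    by rewrite leeDl//; apply: (nnmeas_first_event gam_m gam_0 r_ge0 (nq 0%N)).2.
  case: k @f mA mf f0 nq fk q1 => [|k] f mA mf f0 nq fk q1.
    by apply: (lt_le_trans _ (q1 _)); rewrite /= fk mul1e /expt tw lte_fin expR_gt0.
  apply: (@lt_le_trans _ _ ((expR (- (r k.+1 * (t - w))))%:E *
      \int[mu]_v (gam v * ((eta < v)%R%:R)%:E))).
    by rewrite mule_gt0// lte_fin expR_gt0.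
  have mind : measurable_fun setT (fun v : mR => gam v * ((eta < v)%R%:R)%:E).
    apply: emeasurable_funM => //; apply/measurable_EFinP.
    by apply: measurableT_comp => //; exact: measurable_fun_ltr.
  rewrite -ge0_integralZl//; last first.
    by move=> v _; rewrite mule_ge0// lee_fin.
  apply: ge0_le_integral => //.
  - by move=> v _; rewrite !mule_ge0// lee_fin ?expR_ge0.
  - exact: measurable_funeM.
  - by apply: emeasurable_funM => //;
      exact: (nnmeas_comp _ (nq 1%N) (measurable_cst _) (@measurable_id _ mR setT)).
  - move=> v _; rewrite muleCA lee_wpmul2l//; apply: le_trans (q1 v).
    rewrite /= tw fk mulr1/=; case: ltP => ev /=; last by rewrite mule0 lee_fin; case: ifP.
    by rewrite mule1 (_ : (t - w < v)%R = true)//; lra.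
rewrite -[queue_lt gam r f 2 k.+1 t w]/(no_event r f k.+1 t w +
  ((expR (- (r k.+1 * w)))%:E * serve gam (queue_lt gam r f 1) k (t - w)%R
    + \int[mu]_b (hazard (r k.+1) w b * queue_lt gam r f 1 k.+2 (t - b)%R (w - b)%R))).
apply: (@lt_le_trans _ _ ((expR (- (r k.+1 * w)))%:E * serve gam (queue_lt gam r f 1) k (t - w)%R)).
  by rewrite mule_gt0// lte_fin expR_gt0.
rewrite addeCA leeDl// adde_ge0//.
- exact: (nnmeas_no_event r mf f0).2.
- by apply: integral_ge0 => b _; rewrite mule_ge0 ?hazard_ge0//; exact: (nq 1%N).2.
Qed.

(** If the states with [k] jobs are null, stationarity at the times [j eta] makes null all states
    that reach them with positive probability, among them every valid state with [k + 1] jobs. A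
    null empty state would thus make the whole of [p] vanish. *)
Lemma idle_prob_gt0 p : p (~` valid_state) = 0 -> stationary g r p ->
  0 < p [set s | njobs s = 0%N].
Proof.
move=> p_valid p_stat; rewrite lt_neqAle measure_ge0 andbT; apply/negP => /eqP/esym p0.
have [eta eta0 eta_mass] := job_size_away_from0.
have pk k : p [set s | njobs s = k] = 0.
  elim: k => [//|k IH]; have mA := measurable_njobs k.
  pose B j := [set s : state | trans g r (j%:R * eta)%R s [set s | njobs s = k] != 0].
  have jeta j : (0 <= j%:R * eta)%R by rewrite mulr_ge0// ltW.
  have Bnull j : p.-negligible (B j).
    have mT := measurable_trans g_density r_ge0 (jeta j) mA.
    have [+ _] := ae_eq_integral_abs p measurableT mT.
    case.
      rewrite -[RHS]IH -(p_stat _ _ (jeta j) mA); apply: eq_integral => s _.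
      by rewrite gee0_abs//; exact: (trans_ge0 g_density).
    move=> N [mN N0 sub]; exists N; split => // s /= /eqP ne; apply: sub => /= H.
    by apply: ne; exact: H.
  have Vnull : p.-negligible (~` (valid_state : set state)).
    by apply/negligibleP => //; apply: measurableC; exact: measurable_valid_state.
  apply: measure_negligible; first exact: measurable_njobs.
  apply: negligibleS (negligibleU (negligible_bigcup Bnull) Vnull) => -[i w] /= -> {i}.
  have [w0|w0] := ltP 0%R w; last first.
    by right => -[[]//|[_ /=]]; rewrite /head_size/= ltNge w0.
  (* With [j] the integer part of [w / eta] plus 1, [j eta - eta <= w <= j eta], as
     [trans_service_gt0] asks. *)
  left; exists (Num.truncn (w / eta)).+1 => //=.
  rewrite /B/= gt_eqF//; apply: (trans_service_gt0 _ eta0 eta_mass (jeta _)).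
  have /truncn_itv/andP[le_w lt_w] : (0 <= w / eta)%R by rewrite divr_ge0// ltW.
  rewrite -natr1 mulrDl mul1r addrK -ler_pdivlMr// le_w/=.
  by rewrite -[X in (_ + X)%R]mul1r -mulrDl natr1 -ler_pdivrMr// ltW.
have : p setT = 0.
  apply: measure_negligible => //.
  rewrite (_ : setT = \bigcup_k [set s : state | njobs s = k]); last first.
    by apply/seteqP; split => // s _; exists (njobs s).
  apply: negligible_bigcup => k; apply/negligibleP; [exact: measurable_njobs|exact: pk].
by rewrite probability_setT => /eqP; rewrite onee_eq0.
Qed.

End IdleProbability.

End IdleMixture.

(** * Independent queues *)

Section IidExpectation.
Set Implicit Arguments.
Unset Strict Implicit.
Context {R : realType}.
Local Open Scope ereal_scope.
Local Notation mR := (measurableTypeR R).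
Local Notation state := (nat * mR)%type.
Implicit Types (p q : probability state R) (h : seq state -> \bar R) (c : R).

Lemma eq_iid_expect p q n h : (forall A, measurable A -> p A = q A) ->
  iid_expect p n h = iid_expect q n h.
Proof.
move=> pq; elim: n h => [//|n IH] h /=.
under eq_integral do rewrite IH.
by apply: eq_measure_integral => A mA _; exact: pq.
Qed.

Lemma eq_iid_expect_fun p n h1 h2 : (forall l, h1 l = h2 l) ->
  iid_expect p n h1 = iid_expect p n h2.
Proof. by move=> h12; congr iid_expect; apply/funext. Qed.

Lemma iid_expect_ge0 p n h : (forall l, 0 <= h l) -> 0 <= iid_expect p n h.
Proof.
elim: n h => [//|n IH] h h0 /=; first exact: h0.
by apply: integral_ge0 => s _; exact: IH.
Qed.

Lemma iid_expect_cst p n (a : \bar R) : iid_expect p n (fun=> a) = a.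
Proof.
elim: n => [//|n IH] /=; under eq_integral do rewrite IH.
by rewrite integral_cst//; rewrite [X in _ * X]probability_setT mule1.
Qed.

Fixpoint measurable_list {d} {Y : measurableType d} (fs : seq (Y -> state)) : Prop :=
  if fs is f :: fs' then measurable_fun setT f /\ measurable_list fs' else True.

(* The maps in [fs] play the role of coordinates: quantifying over [Y] amounts to
   measurability on every finite power of the state space. *)
Definition list_measurable h := forall d (Y : measurableType d) (fs : seq (Y -> state)),
  measurable_list fs -> measurable_fun setT (fun y => h [seq f y | f <- fs]).

Lemma measurable_list_comp {d d'} {Y : measurableType d} {Y' : measurableType d'}
    (u : Y' -> Y) (fs : seq (Y -> state)) : measurable_fun setT u ->
  measurable_list fs -> measurable_list [seq f \o u | f <- fs].
Proof.
by move=> mu; elim: fs => [//|f fs IH] [mf mfs]; split; [exact: measurableT_comp|exact: IH].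
Qed.

Lemma measurable_list_rcons {d} {Y : measurableType d} (fs : seq (Y -> state)) f :
  measurable_list fs -> measurable_fun setT f -> measurable_list (rcons fs f).
Proof. by move=> + mf; elim: fs => [//|f' fs IH] [mf' mfs]; split => //; exact: IH. Qed.

(** Tonelli integrates out one draw at a time; in the induction the new draw is the last coordinate
    on the product of [Y] with the state space. *)
Lemma measurable_iid_expect p n h {d} {Y : measurableType d} (fs : seq (Y -> state)) :
  list_measurable h -> (forall l, 0 <= h l) -> measurable_list fs ->
  measurable_fun setT (fun y => iid_expect p n (fun l => h ([seq f y | f <- fs] ++ l))).
Proof.
move=> mh h0; elim: n d Y fs => [|n IH] d Y fs mfs /=.
  rewrite (_ : (fun y => _) = fun y => h [seq f y | f <- fs]); first exact: mh.
  by apply/funext => y; rewrite cats0.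
pose gs := rcons [seq f \o fst | f <- fs] snd : seq (Y * state -> state).
have mgs : measurable_list gs.
  by apply: measurable_list_rcons => //; exact: measurable_list_comp.
have := measurable_fun_fubini_tonelli_F (m2 := p) _ (IH _ _ gs mgs).
rewrite (_ : fubini_F _ _ = fun y => \int[p]_s
    iid_expect p n (fun l => h ([seq f y | f <- fs] ++ s :: l))).
  by apply => x; exact: iid_expect_ge0.
apply/funext => y; apply: eq_integral => s _; apply: eq_iid_expect_fun => l.
by rewrite /gs map_rcons cat_rcons -map_comp.
Qed.

(** A draw from [q] is a draw from [p] with probability [c] and the empty state otherwise. One empty
    state fixes the value at [a], so [h] matters only when all [n] draws come from [p], which has
    probability [c ^+ n]. *)
Lemma iid_expect_idle_mixture p q c n h (a : \bar R) : (0 <= c <= 1)%R ->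
  idle_mixture c p q -> list_measurable h -> (forall l, 0 <= h l) ->
  (forall l, has (fun s => njobs s == 0%N) l -> h l = a) ->
  iid_expect q n h = (c ^+ n)%:E * iid_expect p n h + (1 - c ^+ n)%:E * a.
Proof.
move=> /andP[c0 c1] q_mix mh h0 ha.
have c1' : (0 <= 1 - c)%R by rewrite subr_ge0.
have a0 : 0 <= a by rewrite -(ha [:: empty]).
have cn0 i : (0 <= c ^+ i)%R by rewrite exprn_ge0.
have cn1 i : (0 <= 1 - c ^+ i)%R by rewrite subr_ge0 exprn_ile1.
(* The induction carries the list [l0] of the states drawn so far. *)
suff main l0 : iid_expect q n (fun l => h (l0 ++ l)) =
    (c ^+ n)%:E * iid_expect p n (fun l => h (l0 ++ l)) + (1 - c ^+ n)%:E * a.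
  exact: (main [::]).
elim: n l0 => [|n IH] l0 /=; first by rewrite expr0 mul1e subrr mul0e adde0.
pose X s := iid_expect p n (fun l => h (l0 ++ s :: l)).
have X0 s : 0 <= X s by exact: iid_expect_ge0.
have mX : measurable_fun setT X.
  have := @measurable_iid_expect p n h _ state (rcons [seq (fun=> s) | s <- l0] id) mh h0.
  rewrite (_ : (fun y => _) = X); last first.
    apply/funext => s; apply: eq_iid_expect_fun => l.
    by rewrite map_rcons cat_rcons -map_comp map_id.
  apply; apply: measurable_list_rcons => //.
  by elim: (l0) => [//|s l IHl]; split => //; exact: measurable_cst.
have Xe : X empty = a.
  rewrite -(iid_expect_cst p n a); apply: eq_iid_expect_fun => l.
  by apply: ha; rewrite has_cat /= orbT.
transitivity (\int[q]_s ((c ^+ n)%:E * X s + (1 - c ^+ n)%:E * a)).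
  apply: eq_integral => s _; rewrite /X.
  under eq_iid_expect_fun do rewrite -cat_rcons.
  rewrite IH; congr (_ * _ + _); apply: eq_iid_expect_fun => l.
  by rewrite cat_rcons.
have mcX : measurable_fun setT (fun s => (c ^+ n)%:E * X s) by exact: measurable_funeM.
have Xa0 : 0 <= (1 - c ^+ n)%:E * a by rewrite mule_ge0 ?lee_fin.
have cX0 s : 0 <= (c ^+ n)%:E * X s by rewrite mule_ge0 ?lee_fin.
rewrite q_mix; last 2 first.
- by apply: emeasurable_funD => //; exact: measurable_cst.
- by move=> s; exact: adde_ge0.
rewrite ge0_integralD//.
have int_cst : \int[p]_s ((1 - c ^+ n)%:E * a) = (1 - c ^+ n)%:E * a.
  exact: (iid_expect_cst p 1).
rewrite Xe int_cst ge0_integralZl ?lee_fin//.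
have XI0 : 0 <= \int[p]_s X s by exact: integral_ge0.
have -> : (c ^+ n)%:E * a + (1 - c ^+ n)%:E * a = a.
  by rewrite -ge0_muleDl ?lee_fin ?cn0 ?cn1// -EFinD addrC subrK mul1e.
rewrite ge0_muleDr// ?mule_ge0 ?lee_fin// !muleA -!EFinM -exprS -addeA; congr (_ + _).
rewrite -ge0_muleDl ?lee_fin ?mulr_ge0// -EFinD; congr (_%:E * _).
by rewrite exprS; ring.
Qed.

(** Each length takes countably many values; fixing them one after the other gives measurability for
    an arbitrary [phi]. *)
Lemma list_measurable_njobs (phi : seq nat -> \bar R) :
  list_measurable (fun l => phi [seq njobs s | s <- l]).
Proof.
move=> d Y fs; elim: fs phi => [|f fs IH] phi /=; first by move=> _; exact: measurable_cst.
move=> [mf mfs]; pose F k y := phi (k :: [seq njobs s | s <- [seq f y | f <- fs]]).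
have mF : measurable_fun setT (fun s : nat * Y => F s.1 s.2).
  apply: (@measurable_nat_prod R _ Y F) => k; exact: (IH (fun l => phi (k :: l))).
have mu : measurable_fun setT (fun y => ((f y).1, y)).
  by apply: measurable_fun_pair => //; exact: (measurableT_comp measurable_fst mf).
exact: (measurableT_comp mF mu).
Qed.

Lemma list_measurable_sum (W : nat -> seq nat -> \bar R) (rho : state -> \bar R) :
  measurable_fun setT rho ->
  list_measurable (fun l => \sum_(s <- l) (W (njobs s) [seq njobs s' | s' <- l] * rho s)).
Proof.
move=> mrho d Y fs mfs.
under eq_fun do rewrite big_map.
suff main gs : measurable_list gs -> measurable_fun setT (fun y =>
    \sum_(f <- gs) (W (njobs (f y)) [seq njobs s' | s' <- [seq f y | f <- fs]] * rho (f y))).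
  exact: main.
elim: gs => [|f gs IH] /=.
  by move=> _; under eq_fun do rewrite big_nil; exact: measurable_cst.
move=> [mf mgs]; under eq_fun do rewrite big_cons.
apply: emeasurable_funD; last exact: IH.
apply: emeasurable_funM; last exact: measurableT_comp.
(* The length of [f y] is put in front, so that both arguments of [W] come from one list of lengths;
   the default of [head] is never read. *)
have := list_measurable_njobs (fun l => W (head 0%N l) (behead l)).
by move=> /(_ _ _ (f :: fs)); exact.
Qed.

(** No finiteness of [x] is asked: at infinite [x] both sides are 0. *)
Lemma fineZl c (x : \bar R) : (0 <= c)%R -> fine (c%:E * x) = (c * fine x)%R.
Proof.
case: x => [x| |] //=; rewrite le_eqVlt => /predU1P[<-|c0]; rewrite ?mul0e ?mul0r//.
  by rewrite gt0_muley ?lte_fin// mulr0.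
by rewrite gt0_muleNy ?lte_fin// mulr0.
Qed.

(** * The chance that an empty queue receives the job *)

Section JoinProbability.
Variables (p : probability state R).
Let a : R := fine (p [set s | njobs s = 0%N]).

(* [mean_share n m] is the mean of [1 / (m + 1 + N)], with [N] the number of
   empty queues among [n] independent ones. *)
Fixpoint mean_share (a : R) (n m : nat) : R :=
  if n is n'.+1 then (a * mean_share a n' m.+1 + (1 - a) * mean_share a n' m)%R
  else (m.+1%:R^-1)%R.

Lemma mean_share_ge0 b n m : (0 <= b <= 1)%R -> (0 <= mean_share b n m)%R.
Proof.
move=> /andP[b0 b1]; elim: n m => [|n IH] m /=; first by rewrite invr_ge0.
by rewrite addr_ge0 ?mulr_ge0 ?subr_ge0.
Qed.

(** With [N] empty queues among [n + 1], write [n + m + 2 = (m + 1 + N) + (n + 1 - N)], divide by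
    [m + 1 + N] and take the mean: each of the [n + 1] queues is busy with probability [1 - b], and
    then leaves [n] others to count. *)
Lemma mean_shareS b n m :
  ((n + m).+2%:R * mean_share b n.+1 m = 1 + (1 - b) * n.+1%:R * mean_share b n m)%R.
Proof.
elim: n m => [|n IH] m.
  rewrite /= add0n.
  have m1 : (m.+1%:R != 0 :> R)%R by rewrite pnatr_eq0.
  have m2 : (m.+2%:R != 0 :> R)%R by rewrite pnatr_eq0.
  have mE : (m.+2%:R = m.+1%:R + 1 :> R)%R by rewrite natr1.
  rewrite mE in m2 *; move: m1 m2; move: (m.+1%:R : R)%R => M m1 m2.
  by field; rewrite m1 m2.
have IH1 := IH m.+1; have IH0 := IH m.
rewrite -[mean_share b n.+2 m]/(b * mean_share b n.+1 m.+1 + (1 - b) * mean_share b n.+1 m)%R.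
rewrite addnS in IH1.
set x := mean_share b n.+1 m.+1 in IH1 *; set y := mean_share b n.+1 m in IH0 *.
have yE : y = (b * mean_share b n m.+1 + (1 - b) * mean_share b n m)%R by [].
have -> : ((n.+1 + m).+2%:R = (n + m).+3%:R :> R)%R by [].
rewrite mulrDr [X in (X + _)%R]mulrCA IH1.
have -> : ((n + m).+3%:R * ((1 - b) * y) = (1 - b) * ((n + m).+2%:R * y + y))%R.
  by rewrite -[(n + m).+3%:R]natr1; ring.
rewrite IH0 -[n.+2%:R]natr1 yE; ring.
Qed.

(** The shares of the empty queues among [n + 1] add up to 1 as soon as one of them is empty. *)
Lemma mean_share0 b n : (b * (n.+1%:R * mean_share b n 0) = 1 - (1 - b) ^+ n.+1)%R.
Proof.
elim: n => [|n IH]; first by rewrite /= invr1; ring.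
have := mean_shareS b n 0; rewrite addn0 => ->.
have -> : (b * (1 + (1 - b) * n.+1%:R * mean_share b n 0) =
    b + (1 - b) * (b * (n.+1%:R * mean_share b n 0)))%R by ring.
by rewrite IH [in RHS]exprS; ring.
Qed.

Lemma iid_expect_share n m :
  iid_expect p n (fun l => ((count (fun s => njobs s == 0%N) l + m).+1%:R^-1)%:E) =
  (mean_share a n m)%:E.
Proof.
elim: n m => [|n IH] m //=.
have mI := @measurable_njobs R 0.
have a1 : p (~` [set s | njobs s = 0%N]) = (1 - a)%:E.
  by rewrite probability_setC// EFinB /a fineK// fin_num_measure.
have aE : p [set s | njobs s = 0%N] = a%:E by rewrite /a fineK// fin_num_measure.
have a01 : (0 <= a <= 1)%R by rewrite -!lee_fin -aE measure_ge0 probability_le1.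
transitivity (\int[p]_s ((mean_share a n m.+1)%:E * (\1_[set s : state | njobs s = 0%N] s)%:E
   + (mean_share a n m)%:E * (\1_(~` [set s : state | njobs s = 0%N]) s)%:E)).
  apply: eq_integral => s _; rewrite !indicE in_setC.
  have -> : (s \in [set s : state | njobs s = 0%N]) = (njobs s == 0%N).
    by apply/idP/eqP => [|k0]; rewrite inE.
  case: eqP => _ /=; rewrite ?mule1 ?mule0 ?adde0 ?add0e -IH; apply: eq_iid_expect_fun => l.
    by rewrite add1n addSn addnS.
  by rewrite add0n.
have mf A (b : R) : measurable A -> measurable_fun setT (fun s : state => b%:E * (\1_A s)%:E).
  by move=> mA; apply: measurable_funeM; exact/measurable_EFinP/measurable_indic.
rewrite ge0_integralD//; first last.
- by apply: mf; exact: measurableC.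
- by move=> s _; rewrite mule_ge0 ?lee_fin ?mean_share_ge0.
- exact: mf.
- by move=> s _; rewrite mule_ge0 ?lee_fin ?mean_share_ge0.
rewrite !ge0_integralZl ?lee_fin ?mean_share_ge0//; first last.
- by apply/measurable_EFinP/measurable_indic.
- by apply/measurable_EFinP/measurable_indic; exact: measurableC.
have -> : \int[p]_s (\1_[set s : state | njobs s = 0%N] s)%:E = a%:E.
  by rewrite integral_indic// setIT; exact: aE.
have -> : \int[p]_s (\1_(~` [set s : state | njobs s = 0%N]) s)%:E = (1 - a)%:E.
  by rewrite (integral_indic p measurableT (measurableC mI)) setIT; exact: a1.
by rewrite -!EFinM -EFinD; congr EFin; ring.
Qed.

End JoinProbability.

End IidExpectation.

(** * Equilibria and response times *)

Section Equilibria.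
Set Implicit Arguments.
Unset Strict Implicit.
Context {R : realType}.
Local Open Scope ereal_scope.
Local Notation mR := (measurableTypeR R).
Local Notation state := (nat * mR)%type.
Implicit Types (p q : probability state R) (c lambda : R) (d : nat).

Lemma join_prob_ge0 p d k : (0 <= join_prob p d k)%R.
Proof.
apply: fine_ge0; apply: iid_expect_ge0 => l.
by rewrite lee_fin; case: ifP => // _; rewrite invr_ge0.
Qed.

Lemma tail1E p : tail p 1 = (1 - fine (p [set s | njobs s = 0%N]))%R.
Proof.
have mI := @measurable_njobs R 0.
rewrite /tail (_ : [set s | _] = ~` [set s | njobs s = 0%N]); last first.
  by apply/seteqP; split => s /=; rewrite lt0n => /eqP.
rewrite probability_setC// -[X in 1 - X]fineK ?fin_num_measure//.
Qed.

Lemma arrival_rate_ge0 d lambda (pi0 : R) p k :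
  (0 <= lambda)%R -> (0 <= pi0 <= 1)%R -> (0 <= arrival_rate d lambda pi0 p k)%R.
Proof.
move=> l0 /andP[pi00 pi01]; rewrite addr_ge0//.
  by rewrite !mulr_ge0 ?join_prob_ge0.
case: k => // ; rewrite divr_ge0 ?mulr_ge0 ?subr_ge0//.
by rewrite tail1E gerBl fine_ge0.
Qed.

(** A busy queue gets the job only if the [d - 1] others are busy too, so the integrand is 0 once an
    empty state is drawn. *)
Lemma join_prob_idle_mixture p q c d k : (0 <= c <= 1)%R -> idle_mixture c p q ->
  join_prob q d k.+1 = (c ^+ d.-1 * join_prob p d k.+1)%R.
Proof.
move=> c01 q_mix; rewrite /join_prob.
set h := (X in iid_expect q _ X).
have hE l : h l = (fun ns => (if all (leq k.+1) ns then (count (pred1 k.+1) ns).+1%:R^-1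
    else 0)%R%:E) [seq njobs s | s <- l].
  by rewrite /h all_map count_map.
rewrite (iid_expect_idle_mixture (a := 0) d.-1 c01 q_mix).
- rewrite mule0 adde0 fineZl ?exprn_ge0//; by case/andP: c01.
- move=> e Y fs mfs; rewrite (_ : (fun y => _) = fun y =>
      (fun ns => (if all (leq k.+1) ns then (count (pred1 k.+1) ns).+1%:R^-1
    else 0)%R%:E) [seq njobs s | s <- [seq f y | f <- fs]]).
    exact: (list_measurable_njobs (fun ns => (if all (leq k.+1) ns
      then (count (pred1 k.+1) ns).+1%:R^-1 else 0)%R%:E) mfs).
  by apply/funext => y; rewrite hE.
- by move=> l; rewrite /h lee_fin; case: ifP => // _; rewrite invr_ge0.
- move=> l /hasP[s sl /eqP s0]; rewrite /h ifF//.
  by apply/negbTE/allPn; exists s => //; rewrite s0.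
Qed.

Lemma join_prob_idle p d (a := fine (p [set s | njobs s = 0%N])) : (0 < d)%N ->
  (a * (d%:R * join_prob p d 0) = 1 - (1 - a) ^+ d)%R.
Proof.
case: d => // d _; rewrite /join_prob /=.
have -> : iid_expect p d (fun l => (if all (fun s => (0 <= njobs s)%N) l
    then ((count (fun s => njobs s == 0%N) l).+1%:R)^-1 else 0)%R%:E) = (mean_share a d 0)%:E.
  rewrite -iid_expect_share; apply: eq_iid_expect_fun => l.
  by rewrite addn0 (_ : all _ l = true)//; apply/allP.
exact: mean_share0.
Qed.

(* Every job is sent to an idle server, except those that find an empty memory and
   [d] busy queues. *)
Lemma idle_flow d lambda (pi0 : R) p (a := fine (p [set s | njobs s = 0%N])) :
  (0 < d)%N -> (0 < a)%R ->
  (a * arrival_rate d lambda pi0 p 0 = lambda * (1 - pi0 * (1 - a) ^+ d))%R.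
Proof.
move=> d0 a0; have jE := join_prob_idle p d0; rewrite -/a in jE.
rewrite /arrival_rate tail1E -/a subKr.
have -> : (a * (lambda * d%:R * pi0 * join_prob p d 0 + lambda * (1 - pi0) / a) =
    lambda * pi0 * (a * (d%:R * join_prob p d 0)) + lambda * (1 - pi0))%R.
  by field; rewrite gt_eqF.
by rewrite jE; ring.
Qed.

Lemma idle_mixture_idle_prob p q c : idle_mixture c p q ->
  fine (q [set s | njobs s = 0%N]) = (1 - c + c * fine (p [set s | njobs s = 0%N]))%R.
Proof.
move=> q_mix; have mI := @measurable_njobs R 0.
rewrite (idle_mixtureE mI q_mix) indicE mem_set// mule1 -[p _]fineK ?fin_num_measure//.
by rewrite -EFinM -EFinD /= addrC.
Qed.

Lemma equilibrium_idle_mixture (g : R -> R) (m : R) d lambda (pi0 : R) c p q :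
  job_size_density g m -> (0 < d)%N -> (0 < lambda)%R -> (0 < c <= 1)%R ->
  pi0 = (c ^+ d)%R -> idle_mixture c p q -> equilibrium g d lambda pi0 p ->
  equilibrium g d (lambda * c) 1 q.
Proof.
move=> gd d0 l0 /andP[c0 c1] pi0E q_mix [p_valid p_stat].
have c01 : (0 <= c <= 1)%R by rewrite ltW.
have pi01 : (0 <= pi0 <= 1)%R by rewrite pi0E exprn_ge0 ?exprn_ile1// ltW.
have r0 k := arrival_rate_ge0 d p k (ltW l0) pi01.
have r'0 k : (0 <= arrival_rate d (lambda * c) 1 q k)%R.
  by apply: arrival_rate_ge0; rewrite ?ler01 ?lexx// mulr_ge0// ltW.
set a := fine (p [set s | njobs s = 0%N]).
(* The rate in the empty state divides by this probability. *)
have a_gt0 : (0 < a)%R.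
  have := idle_prob_gt0 gd r0 p_valid p_stat.
  by rewrite -[p _]fineK ?fin_num_measure ?lte_fin//; exact: measurable_njobs.
have aq := idle_mixture_idle_prob q_mix; rewrite -/a in aq.
have aq_gt0 : (0 < fine (q [set s | njobs s = 0%N]))%R.
  by rewrite aq ltr_wpDl ?mulr_gt0// subr_ge0.
have flow := idle_flow lambda pi0 d0 a_gt0.
have flow' := idle_flow (lambda * c) 1 d0 aq_gt0.
rewrite aq in flow'.
(* Both sides are [lambda c (1 - c ^+ d (1 - a) ^+ d)], since [q] is busy with probability
   [c (1 - a)]. *)
have flowE : (c * (a * arrival_rate d lambda pi0 p 0) =
    (1 - c + c * a) * arrival_rate d (lambda * c) 1 q 0)%R.
  rewrite flow flow' pi0E.
  have -> : (1 - (1 - c + c * a) = c * (1 - a))%R by ring.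
  by rewrite exprMn; ring.
have balance : (c * a * (arrival_rate d lambda pi0 p 0 - arrival_rate d (lambda * c) 1 q 0)
    = (1 - c) * arrival_rate d (lambda * c) 1 q 0)%R.
  by rewrite mulrBr -mulrA flowE; ring.
split.
  rewrite (idle_mixtureE (measurableC measurable_valid_state) q_mix) p_valid mule0 add0e.
  by rewrite indicE memNset ?mule0// => /=; apply; left.
apply: (stationary_idle_mixture gd r0 r'0 _ _ c01 p_valid p_stat q_mix balance).
(* Of the [d] factors [c] in [pi0], one goes into the reduced arrival rate and [d - 1] into
   [join_prob]. *)
- move=> k; rewrite /arrival_rate !addr0 (join_prob_idle_mixture d k c01 q_mix) pi0E.
  have -> : (c ^+ d = c * c ^+ d.-1)%R by rewrite -exprS prednK.
  by ring.
(* By the balance, a positive multiple of the difference of the rates is [1 - c] times a nonnegative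
   rate. *)
- rewrite -subr_ge0 -(pmulr_rge0 _ (mulr_gt0 c0 a_gt0)) balance.
  by rewrite mulr_ge0// subr_ge0.
Qed.

End Equilibria.

(** * Response time laws under the two equilibria *)

Section ResponseTime.
Set Implicit Arguments.
Unset Strict Implicit.
Context {R : realType}.
Local Open Scope ereal_scope.
Local Notation mu := (@lebesgue_measure R).
Local Notation mR := (measurableTypeR R).
Local Notation state := (nat * mR)%type.
Variables (g : R -> R) (m : R).
Hypothesis g_density : job_size_density g m.
Variable A : set mR.
Hypothesis mA : measurable A.

Let gam_0 := size_density_ge0 g_density.

Lemma sum_sizes_ge0 n a : 0 <= sum_sizes g n a A.
Proof.
elim: n a => [|n IH] a /=; first by rewrite lee_fin.
rewrite job_expectE; apply: integral_ge0 => v _; exact: mule_ge0.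
Qed.

Lemma measurable_sum_sizes n : measurable_fun setT (fun a : mR => sum_sizes g n a A).
Proof.
elim: n => [|n IH] /=; first exact/measurable_EFinP/measurable_indic.
under eq_fun do rewrite job_expectE.
apply: (@measurable_weighted_integral _ _ mR (fun x => size_density g x.2)
  (fun x => sum_sizes g n (x.1 + x.2)%R A)).
- exact: (measurableT_comp (measurable_size_density g_density) measurable_snd).
- by apply: (measurableT_comp IH); exact: measurable_funD.
- by move=> x; exact: gam_0.
- by move=> x; exact: sum_sizes_ge0.
Qed.

Lemma response_from_ge0 (s : state) : 0 <= response_from g s A.
Proof. by rewrite /response_from; case: (njobs s) => *; exact: sum_sizes_ge0. Qed.

Lemma measurable_response_from : measurable_fun setT (fun s : state => response_from g s A).
Proof.
pose F k (w : mR) := if k is 0 then sum_sizes g 1 0 A else sum_sizes g k w A.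
apply: (@measurable_nat_prod R _ mR F) => -[|k]; first exact: measurable_cst.
exact: measurable_sum_sizes.
Qed.

Definition mean_response (l : seq state) : \bar R :=
  ((size (shortest l))%:R^-1)%:E * \sum_(s <- shortest l) response_from g s A.

(** Weight of a queue of length [k] in the uniform choice among the shortest. It depends on lengths
    only, which brings [mean_response] into the form of [list_measurable_sum]. *)
Definition tie_weight (k : nat) (ns : seq nat) : \bar R :=
  (if all (leq k) ns then (count (fun i => all (leq i) ns) ns)%:R^-1 else 0)%R%:E.

Lemma mean_responseE l : mean_response l =
  \sum_(s <- l) (tie_weight (njobs s) [seq njobs s' | s' <- l] * response_from g s A).
Proof.
rewrite /mean_response ge0_sume_distrr; last by move=> s _; exact: response_from_ge0.
rewrite /shortest big_filter big_mkcond size_filter; apply: eq_bigr => s _.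
have sE u : all (leq (njobs u)) [seq njobs s' | s' <- l] =
    all (fun s' => (njobs u <= njobs s')%N) l by rewrite all_map.
rewrite /tie_weight sE; case: ifP => _; last by rewrite mul0e.
by rewrite count_map; congr (_%:R^-1%:E * _); apply: eq_count => u; rewrite /= sE.
Qed.

Lemma mean_response_ge0 l : 0 <= mean_response l.
Proof.
rewrite mule_ge0 ?lee_fin ?invr_ge0//; apply: sume_ge0 => s _.
exact: response_from_ge0.
Qed.

(** The shortest queues are then the empty ones, and all of them yield the same law because
    [response_from] ignores the head size of a queue without jobs. *)
Lemma mean_response_idle l : has (fun s => njobs s == 0%N) l ->
  mean_response l = response_from g empty A.
Proof.
move=> l_idle; rewrite /mean_response.
have sE : shortest l = [seq s <- l | njobs s == 0%N].
  apply: eq_in_filter => s sl; apply/allP/eqP => [s_min|-> //].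
  have /hasP[s' s'l /eqP s'0] := l_idle.
  by apply/eqP; rewrite -leqn0 -s'0; exact: s_min.
have N0 : (0 < size (shortest l))%N by rewrite sE size_filter -has_count.
have -> : \sum_(s <- shortest l) response_from g s A =
    ((size (shortest l))%:R)%:E * response_from g empty A.
  rewrite sE; elim: (l) => [|s l' IH] /=; first by rewrite big_nil mul0e.
  case: eqP => // s0; rewrite big_cons IH /= -natr1 EFinD ge0_muleDl ?lee_fin// mul1e addeC.
  by congr (_ + _); rewrite /response_from s0.
by rewrite muleA -EFinM mulVf ?mul1e// pnatr_eq0 -lt0n.
Qed.

(** The weight [1 - c ^+ d] that the mixture adds to the response from an empty queue is the
    probability that the memory provides an idle server. *)
Lemma response_law_idle_mixture (p q : probability state R) c d :
  (0 <= c <= 1)%R -> idle_mixture c p q ->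
  response_law g d (c ^+ d)%R p A = response_law g d 1%R q A.
Proof.
move=> c01 q_mix; rewrite /response_law subrr mul0e add0e mul1e.
rewrite (iid_expect_idle_mixture d c01 q_mix _ mean_response_ge0 mean_response_idle).
  by rewrite addeC.
have := list_measurable_sum tie_weight measurable_response_from.
by congr list_measurable; apply/funext => l; rewrite mean_responseE.
Qed.

End ResponseTime.

Theorem theorem4 (R : realType) (d : nat) (g : R -> R) (mu lambda pi0 : R)
    (p p' : probability (state R) R)
    (d1 d2 : measure_display)
    (O1 : measurableType d1) (O2 : measurableType d2)
    (P1 : probability O1 R) (P2 : probability O2 R)
    (RT : {RV P1 >-> measurableTypeR R})
    (RT' : {RV P2 >-> measurableTypeR R}) :
  (1 <= d)%N ->
  0 < mu -> job_size_density g mu^-1 ->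
  0 < lambda -> lambda < mu ->
  0 < pi0 -> pi0 <= 1 ->
  the_equilibrium g d lambda pi0 p ->
  classic_the_equilibrium g d (lambda * pi0 `^ (d%:R^-1)) p' ->
  is_response_time g d pi0 p RT ->
  classic_is_response_time g d p' RT' ->
  forall A : set (measurableTypeR R), measurable A ->
    distribution P1 RT A = distribution P2 RT' A.
Proof.
move=> d_gt0 _ g_density lambda_gt0 _ pi0_gt0 pi0_le1 [p_eq _] [_ p'_unique] RTE RT'E A mA.
set c := pi0 `^ d%:R^-1 in p'_unique.
have c_gt0 : 0 < c by exact: powR_gt0.
(* The exponent [1 / d] is chosen so that [d] draws from the mixture all come from [p] with
   probability [pi0]. *)
have pi0E : pi0 = c ^+ d.
  rewrite -powR_mulrn ?ltW// -powRrM mulVf ?powRr1 ?ltW//.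
  by rewrite pnatr_eq0 -lt0n.
have c_le1 : c <= 1.
  by rewrite -(expr_le1 d_gt0 (ltW c_gt0)) -pi0E.
have c01 : 0 <= c <= 1 by rewrite ltW.
have [q q_mix] := idle_mixture_exists p c01.
have c01' : 0 < c <= 1 by rewrite c_gt0.
have q_eq := equilibrium_idle_mixture g_density d_gt0 lambda_gt0 c01' pi0E q_mix p_eq.
(* Uniqueness of the equilibrium without memory identifies the mixture with [p'] on measurable
   sets. *)
have qp' := p'_unique q q_eq.
rewrite RTE// RT'E// pi0E (response_law_idle_mixture g_density mA d c01 q_mix).
by rewrite /response_law (eq_iid_expect d _ qp').
Qed.
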